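(* Assume that $\mathscr H$ is a bounded operator on $\ell^s$ of its index set, for some $1\le s\le\infty$, and that all its entries are nonnegative. Let $\varrho=\rho(\mathscr H)$ be its spectral radius on this space. If $|\tau|\varrho<1$, then (for each fixed $m$, as $N\to\infty$) the convergents $\Phi_m^{[N]}$ converge locally uniformly to $\Phi_m$. More precisely, choose any $\gamma>\varrho$ such that $|\tau|\gamma<1$, and put \[ C_\gamma=\sup_{k\ge0}\frac{\|\mathscr H^k\|_s}{\gamma^k}<\infty . \] Then, for $0\le m\le N$, \[ \bigl\|\Phi_m(\tau)-\Phi_m^{[N]}(\tau)\bigr\|_s\le C_\gamma\,\frac{(|\tau|\gamma)^{2(N-m+1)}}{1-|\tau|\gamma}. \] For real $0\le\tau<\varrho^{-1}$, every finite convergent is nonnegative and, for fixed $m$, \[ 0\le\Phi_m^{[N]}(\tau)\le\Phi_m^{[N+1]}(\tau)\le\Phi_m(\tau) \] entrywise. In the same real range, the denominator matrices $\mathsf D_k^{[N]}(\tau)$ $(m\le k\le N)$ of the backward recursion are nonsingular $M$-matrices.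
   Context: Let $p,q\ge1$, $M=p+q$, $d=\gcd(p,q)$, $P=p/d$, $Q=q/d$, $R=P+Q$. Let $L_1,\dots,L_p$ be semi-infinite (indexed by $\mathbb N_0$) lower bidiagonal matrices with $(L_a)_{n,n}=1$, $(L_a)_{n+1,n}=\ell_n^{(a)}$, and $U_1,\dots,U_q$ upper bidiagonal with $(U_b)_{n,n}=u_n^{(b)}$, $(U_b)_{n,n+1}=1$. Height-ordered matrix $\mathscr H$ of the order $L_1,\dots,L_p,U_q,\dots,U_1$: put $\omega_j=(j-1)Q$ for $1\le j\le p$ and $\omega_{p+b}=(q-b+1)P$ for $1\le b\le q$. Rows and columns are indexed by pairs $(h,j)$ with $h\in\mathbb N_0$, $j\in\{1,\dots,M\}$, $h-\omega_j\in R\mathbb N_0$, ordered by $h$ and then $j$; $n_j(h)=(h-\omega_j)/R$; $j^+=j+1$ for $j<M$, $M^+=1$. The only nonzero entries are $\mathscr H_{(h,j),(h+Q,j^+)}=1$; $\mathscr H_{(h,j),(h-P,j^+)}=\ell^{(j)}_{n_j(h)-1}$ for $1\le j\le p$, $n_j(h)\ge1$; $\mathscr H_{(h,p+b),(h-P,(p+b)^+)}=u^{(q-b+1)}_{n_{p+b}(h)}$ for $1\le b\le q$. Height blocks: $w=\max(P,Q)$; $\mathscr V_m$ is the finite set of indices with $mw\le h<(m+1)w$. $\mathscr H$ is block tridiagonal for $\mathscr V_0,\mathscr V_1,\dots$ with blocks $\mathsf A_m$ ($\mathscr V_m\times\mathscr V_m$), $\mathsf B_m$ ($\mathscr V_m\times\mathscr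 V_{m+1}$), $\mathsf C_m$ ($\mathscr V_{m+1}\times\mathscr V_m$). $\mathscr H^{\langle m\rangle}$ and $\mathscr H^{[m,N]}$ are the principal submatrices on $\bigcup_{k\ge m}\mathscr V_k$ and $\bigcup_{k=m}^N\mathscr V_k$; $\Phi_m(\tau)$ and $\Phi_m^{[N]}(\tau)$ are the $\mathscr V_m\times\mathscr V_m$ blocks of $(I-\tau\mathscr H^{\langle m\rangle})^{-1}$ and $(I-\tau\mathscr H^{[m,N]})^{-1}$. Backward recursion: $\mathsf D_N^{[N]}(\tau)=I-\tau\mathsf A_N$ and $\mathsf D_k^{[N]}(\tau)=I-\tau\mathsf A_k-\tau^2\mathsf B_k\bigl(\mathsf D_{k+1}^{[N]}(\tau)\bigr)^{-1}\mathsf C_k$ for $m\le k<N$. $\|\cdot\|_s$ is the $\ell^s$ norm for vectors and the subordinate operator norm for matrices. A real square matrix is a nonsingular $M$-matrix if its off-diagonal entries are nonpositive, it is invertible, and its inverse is entrywise nonnegative. *)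

(* Defs.v *)
From mathcomp Require Export all_boot all_order all_algebra.
From mathcomp Require Export all_classical all_reals all_analysis.
From mathcomp Require Export complex.

Set Implicit Arguments.
Unset Strict Implicit.
Unset Printing Implicit Defensive.

Export Order.TTheory GRing.Theory Num.Theory.
Export numFieldNormedType.Exports.
Export Normc.

#[global] Open Scope classical_set_scope.
#[global] Open Scope ring_scope.
#[global] Open Scope complex_scope.

(** * Complex sequence spaces ℓ^s and their operators *)

(* ‖x‖_s for 1 <= s <= +oo. The maximum with 0 only matters for an empty
   index set, where the supremum in \bar R would be -oo. *)
Definition lsnorm (R : realType) (T : choiceType) (s : \bar R)
    (x : T -> R[i]) : \bar R :=
  match s with
  | r%:E => (poweR (\esum_(i in [set: T]) (powR (normc (x i)) r)%:E) r^-1)%E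
  | +oo%E => maxe 0%E (ereal_sup [set (normc (x i))%:E | i in [set: T]])
  | -oo%E => 0%E
  end.

Definition lspace (R : realType) (T : choiceType) (s : \bar R) :
    set (T -> R[i]) := [set x | (lsnorm s x < +oo)%E].

Definition opnorm (R : realType) (T U : choiceType) (s : \bar R)
    (F : (T -> R[i]) -> (U -> R[i])) : \bar R :=
  ereal_sup [set lsnorm s (F x) | x in [set x | (lsnorm s x <= 1)%E]].

(* Operators are total functions on all sequences; only their restriction to
   ℓ^s is meaningful. *)
Definition bounded_op (R : realType) (T : choiceType) (s : \bar R)
    (F : (T -> R[i]) -> (T -> R[i])) : Prop :=
  (forall (a : R[i]) (x y : T -> R[i]), lspace s x -> lspace s y ->
     F (a *: x + y) = a *: F x + F y)
  /\ (opnorm s F < +oo)%E.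

Definition inverse_op (R : realType) (T : choiceType) (s : \bar R)
    (F G : (T -> R[i]) -> (T -> R[i])) : Prop :=
  bounded_op s G /\ forall x, lspace s x -> G (F x) = x /\ F (G x) = x.

Definition spectrum (R : realType) (T : choiceType) (s : \bar R)
    (F : (T -> R[i]) -> (T -> R[i])) : set R[i] :=
  [set z | ~ exists G, inverse_op s (fun x => z *: x - F x) G].

Definition spectral_radius (R : realType) (T : choiceType) (s : \bar R)
    (F : (T -> R[i]) -> (T -> R[i])) : R :=
  sup [set normc z | z in spectrum s F].

(* The operator of an infinite matrix. The sum ranges over the finite support
   of its summand, so it is the true matrix action for row-finite matrices. *)
Definition mxop (R : realType) (T : choiceType) (A : T -> T -> R[i])
    (x : T -> R[i]) : T -> R[i] :=
  fun i => \sum_(j \in [set: T]) A i j * x j.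

(* ℓ^s operator norm of a finite matrix acting on column vectors. *)
Definition mxnorm (R : realType) (m n : nat) (s : \bar R)
    (A : 'M[R[i]]_(m, n)) : \bar R :=
  opnorm s (fun (x : 'I_n -> R[i]) (i : 'I_m) => (A *m \col_j x j) i ord0).

(* (I - tau A)^{-1}, as an arbitrary bounded inverse on ℓ^s: all of them agree
   on ℓ^s. It is the zero map if there is none. *)
Definition resolvent (R : realType) (T : choiceType) (s : \bar R)
    (A : T -> T -> R[i]) (tau : R[i]) : (T -> R[i]) -> (T -> R[i]) :=
  xget (fun _ _ => 0) [set G | inverse_op s (fun x => x - tau *: mxop A x) G].

Definition nonsingular_Mmatrix (R : realType) (n : nat)
    (A : 'M[R[i]]_n) : Prop :=
  [/\ forall i j, A i j \is Num.real,
      forall i j, i != j -> A i j <= 0,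
      A \in unitmx
    & forall i j, 0 <= invmx A i j].

(** * The height-ordered matrix *)

(* Indices (h, j) are pairs of naturals with 1 <= j <= p + q; likewise ell a n
   is ℓ_n^{(a)} for 1 <= a <= p and u b n is u_n^{(b)} for 1 <= b <= q, other
   values of a and b being irrelevant. *)

Definition stepP (p q : nat) : nat := (p %/ gcdn p q)%N.
Definition stepQ (p q : nat) : nat := (q %/ gcdn p q)%N.
Definition stepR (p q : nat) : nat := (stepP p q + stepQ p q)%N.
Definition width (p q : nat) : nat := maxn (stepP p q) (stepQ p q).

Definition omega (p q j : nat) : nat :=
  if (j <= p)%N then (j.-1 * stepQ p q)%N
  else ((q - (j - p) + 1) * stepP p q)%N.

Definition succj (p q j : nat) : nat := if (j < p + q)%N then j.+1 else 1%N.

Definition is_index (p q : nat) (x : nat * nat) : bool :=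
  [&& 1 <= x.2 <= p + q, omega p q x.2 <= x.1
    & stepR p q %| x.1 - omega p q x.2]%N.

Definition level (p q : nat) (x : nat * nat) : nat :=
  ((x.1 - omega p q x.2) %/ stepR p q)%N.

(* In the second case 0 < level x when x.2 <= p; for x.2 = p + b, b >= 1, the
   superscript q - b + 1 is q - (x.2 - p) + 1. *)
Definition Hentry (R : realType) (p q : nat) (ell u : nat -> nat -> R[i])
    (x y : nat * nat) : R[i] :=
  if y.2 != succj p q x.2 then 0
  else if y.1 == (x.1 + stepQ p q)%N then 1
  else if (y.1 + stepP p q)%N == x.1 then
    if (x.2 <= p)%N then
      if (1 <= level p q x)%N then ell x.2 (level p q x).-1 else 0
    else u (q - (x.2 - p) + 1)%N (level p q x)
  else 0.

(* The union of the height blocks V_k, k >= m. For m = 0 it is the whole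
   index set. *)
Definition hindex (p q m : nat) : Type :=
  {x : nat * nat | is_index p q x && (m * width p q <= x.1)%N}.

(* H^{<m>}; the full matrix H is Htail 0. *)
Definition Htail (R : realType) (p q : nat) (ell u : nat -> nat -> R[i])
    (m : nat) (x y : hindex p q m) : R[i] :=
  Hentry p q ell u (val x) (val y).

(* V_m, listed by h and then j. *)
Definition block (p q m : nat) : seq (hindex p q m) :=
  pmap insub [seq (h, j) | h <- iota (m * width p q)%N (width p q),
                           j <- iota 1 (p + q)%N].

Definition bsize (p q m : nat) : nat := size (block p q m).

Definition bindex (p q m : nat) (i : 'I_(bsize p q m)) : hindex p q m :=
  tnth (in_tuple (block p q m)) i.

Definition Hblock (R : realType) (p q : nat) (ell u : nat -> nat -> R[i])
    (k l : nat) : 'M[R[i]]_(bsize p q k, bsize p q l) :=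
  \matrix_(i, j) Hentry p q ell u (val (bindex i)) (val (bindex j)).

(* H^{[m, m + n]}, as a block matrix. The index is written i + m, so that the
   size of block ord0 is convertible to bsize p q m. *)
Definition Hsection (R : realType) (p q : nat) (ell u : nat -> nat -> R[i])
    (m n : nat) : 'M[R[i]]_(\sum_(i < n.+1) bsize p q (i + m)%N) :=
  \mxblock_(i < n.+1, j < n.+1) Hblock p q ell u (i + m)%N (j + m)%N.

Definition Phi (R : realType) (p q : nat) (ell u : nat -> nat -> R[i])
    (s : \bar R) (m : nat) (tau : R[i]) : 'M[R[i]]_(bsize p q m) :=
  \matrix_(i, j) resolvent s (@Htail R p q ell u m) tau
                   (fun y => (y == bindex j)%:R) (bindex i).

(* Phi_m^{[N]}, meaningful for m <= N. *)
Definition Phi_fin (R : realType) (p q : nat) (ell u : nat -> nat -> R[i])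
    (m N : nat) (tau : R[i]) : 'M[R[i]]_(bsize p q m) :=
  submxblock (invmx (1%:M - tau *: Hsection p q ell u m (N - m))) ord0 ord0.

(* D_k^{[k + n]} *)
Fixpoint Drec (R : realType) (p q : nat) (ell u : nat -> nat -> R[i])
    (tau : R[i]) (n k : nat) : 'M[R[i]]_(bsize p q k) :=
  let A := Hblock p q ell u k k in
  let B := Hblock p q ell u k k.+1 in
  let C := Hblock p q ell u k.+1 k in
  match n with
  | 0%N => 1%:M - tau *: A
  | n'.+1 => 1%:M - tau *: A
             - tau ^+ 2 *: (B *m invmx (Drec p q ell u tau n' k.+1) *m C)
  end.

(* D_k^{[N]}, meaningful for k <= N. *)
Definition Dmx (R : realType) (p q : nat) (ell u : nat -> nat -> R[i])
    (N k : nat) (tau : R[i]) : 'M[R[i]]_(bsize p q k) :=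
  Drec p q ell u tau (N - k) k.

Definition Cgamma (R : realType) (p q : nat) (ell u : nat -> nat -> R[i])
    (s : \bar R) (gamma : R) : \bar R :=
  ereal_sup [set (opnorm s (iter k (mxop (@Htail R p q ell u 0)))
                    * (gamma ^- k)%:E)%E | k in [set: nat]].

(* Main.v *)
Require Import Defs.
From mathcomp Require Import ring lra zify.

(** Nonnegativity of the matrix H replaces both complex analysis and matrix
    algebra: everything is deduced from a bound [|| H^k || <= K gamma^k] by a
    maximum principle ([maximum_principle]): a real sequence [d] with
    [d <= |tau| H d] wherever [d > 0] is nonpositive as soon as
    [|tau| gamma < 1], since its positive part is dominated by
    [|tau|^k H^k] applied to itself.

    The bound itself holds for every [gamma] above the spectral radius
    ([spectral_radius_power_bounded]). For this only the resolvent at real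
    points is used. If the infimum of the growth rates of the powers exceeded
    the spectral radius, the resolvent would exist, and still be nonnegative, at
    some [l] below that infimum; but a nonnegative resolvent at [l] dominates
    [H^k / l^(k+1)] for every [k], so [l] would be a growth rate as well.

    The matrices Phi and their convergents are traces on block [m] of solutions
    of [x = e + tau H x] restricted to the blocks from [m] on, respectively to
    the blocks [m, .., N] ([Phi_solves], [Phi_fin_solves]). Both are viewed on
    the whole index set. Enlarging the set of blocks adds nonnegative terms,
    whence the monotonicity in [N] ([solves_le]). For the error estimate, H is
    block tridiagonal, so that a closed walk from block [m] can leave the blocks
    [m, .., N] only if it has at least [2 (N - m + 1)] steps; accordingly the
    difference of the two solutions is dominated, on block [m], by the part of
    the Neumann series with exponents at least [2 (N - m + 1)]
    ([truncation_error]).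

    The denominators of the backward recursion are Schur complements:
    [D_k v] is the source in block [k] for which the solution on the blocks
    [k, .., N] has trace [v] ([lifts]). The maximum principle then says that
    [D_k] is injective with nonnegative inverse, and nonnegativity of the inverse
    of [D_(k+1)] makes [I - D_k] nonnegative, which gives the signs off the
    diagonal. *)

Set Implicit Arguments.
Unset Strict Implicit.
Unset Printing Implicit Defensive.

(** * The norm of sequence spaces *)

Section SequenceNorm.
Context {R : realType} {s : \bar R}.
Hypothesis hs : (1 <= s)%E.

(** Norms enter the estimates only through bounds by real constants, and
    through real sequences such as the moduli of a complex one; this keeps
    the arithmetic in R and out of the extended reals. *)
Definition normle (T : choiceType) (f : T -> R) (c : R) : Prop :=
  (lsnorm s (fun i => (f i)%:C) <= c%:E)%E.


Lemma normc_real (x : R) : normc x%:C = `|x|.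
Proof. by rewrite /normc /= expr0n/= addr0 sqrtr_sqr. Qed.

Lemma normc_ge0 (x : R[i]) : 0 <= normc x.
Proof. by case: x => a b; rewrite /= sqrtr_ge0. Qed.

Lemma lsnorm_normle (T : choiceType) (x : T -> R[i]) c :
  (lsnorm s x <= c%:E)%E <-> normle (fun i => normc (x i)) c.
Proof.
rewrite /normle; suff -> : lsnorm s x = lsnorm s (fun i => (normc (x i))%:C) by [].
have e i : normc (normc (x i))%:C = normc (x i).
  by rewrite normc_real ger0_norm ?normc_ge0.
rewrite /lsnorm; case: s => //= [r|].
  by congr (_ `^ _)%E; apply: eq_esum => i _; rewrite -[in LHS]e.
by congr (maxe _ (ereal_sup _)); apply: eq_imagel => i _; rewrite -[in LHS]e.
Qed.

Lemma normle_seqP (r : R) (T : choiceType) (f : T -> R) c : s = r%:E -> 0 <= c ->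
  normle f c <->
  forall X : seq T, uniq X -> \sum_(i <- X) powR `|f i| r <= powR c r.
Proof.
move=> sE c0; rewrite /normle sE.
have r1 : 1 <= r by move: hs; rewrite sE lee_fin.
have r0 : 0 < r by lra.
rewrite [lsnorm _ _](_ : _ = ((\esum_(i in [set: T]) (powR `|f i| r)%:E) `^ r^-1)%E);
  last by congr (_ `^ _)%E; apply: eq_esum => i _; rewrite -normc_real.
set E := (\esum_(i in _) _)%E.
have E0 : (0 <= E)%E by apply: esum_ge0 => i _; rewrite lee_fin powR_ge0.
have -> : (E `^ r^-1 <= c%:E)%E = (E <= (powR c r)%:E)%E.
  apply/idP/idP => h.
    have -> : E = ((E `^ r^-1) `^ r)%E by rewrite -poweRrM mulVf ?gt_eqF// poweRe1.
    rewrite -poweR_EFin gt0_ler_poweR// ?in_itv/= ?andbT ?leey ?lee_fin ?poweR_ge0 ?c0 ?(ltW r0)//.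
  have -> : c%:E = ((powR c r)%:E `^ r^-1)%E.
    by rewrite poweR_EFin -powRrM mulfV ?gt_eqF// powRr1.
  apply: gt0_ler_poweR; rewrite ?invr_ge0 ?(ltW r0)//= in_itv/= ?E0 ?leey//.
  by rewrite lee_fin powR_ge0.
split=> [h X uX|h].
  rewrite -lee_fin; apply: le_trans h; apply: esum_ge.
  exists [set` X]; first by split.
  by rewrite -fsbig_seq// sumEFin.
apply: ge_ereal_sup => _ [X [Xf _] <-].
by rewrite fsbig_finite// sumEFin lee_fin h.
Qed.

Lemma normle_ooP (T : choiceType) (f : T -> R) c : s = +oo%E -> 0 <= c ->
  normle f c <-> forall i, `|f i| <= c.
Proof.
move=> sE c0; rewrite /normle sE [lsnorm _ _]/(maxe _ _) ge_max lee_fin c0 andTb; split=> [h i|h].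
  rewrite -lee_fin; apply: le_trans h; apply: ereal_sup_ubound.
  by exists i => //; rewrite normc_real.
by apply: ge_ereal_sup => _ [i _ <-]; rewrite normc_real lee_fin.
Qed.

Lemma lsnorm_ge0 (T : choiceType) (x : T -> R[i]) : (0 <= lsnorm s x)%E.
Proof. by rewrite /lsnorm; case: s => [r||] //; rewrite ?poweR_ge0 ?le_max ?lexx. Qed.

Lemma normle_ge0 (T : choiceType) (f : T -> R) c : normle f c -> 0 <= c.
Proof. by move=> h; rewrite -lee_fin; apply: le_trans h; apply: lsnorm_ge0. Qed.

Lemma exponent_cases : (exists2 r, s = r%:E & 1 <= r) \/ s = +oo%E.
Proof. by move: hs; case: s => // [r|_]; [left; exists r|right]. Qed.

(** Injectivity is asked on the support only, so that [phi] can be the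
    inclusion of an index set as well as a left inverse of such an
    inclusion. *)
Lemma normle_inj (T U : choiceType) (f : T -> R) (g : U -> R) (phi : T -> U) c :
  (forall i j, f i != 0 -> f j != 0 -> phi i = phi j -> i = j) ->
  (forall i, `|f i| <= `|g (phi i)|) -> normle g c -> normle f c.
Proof.
move=> inj fg hg; have c0 := normle_ge0 hg.
have [[r sE r1]|sE] := exponent_cases; last first.
  by apply/normle_ooP => // i; apply: le_trans (fg i) _; move/normle_ooP: hg; apply.
move/(normle_seqP _ sE c0): hg => hg; apply/(normle_seqP _ sE c0) => X uX.
pose X' := [seq i <- X | f i != 0].
have -> : \sum_(i <- X) powR `|f i| r = \sum_(i <- X') powR `|f i| r.
  rewrite big_filter [LHS](bigID (fun i => f i != 0))/= [X in _ + X]big1 ?addr0// => i.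
  by rewrite negbK => /eqP ->; rewrite normr0 powR0//; apply: lt0r_neq0; lra.
apply: le_trans (hg (map phi X') _); last first.
  rewrite map_inj_in_uniq ?filter_uniq// => i j.
  by rewrite !mem_filter => /andP[i0 _] /andP[j0 _]; apply: inj.
rewrite big_map; apply: ler_sum => i _.
by apply: ge0_ler_powR; rewrite ?nnegrE//; lra.
Qed.

Lemma normle_mono (T : choiceType) (f g : T -> R) c :
  (forall i, `|f i| <= `|g i|) -> normle g c -> normle f c.
Proof. exact: (normle_inj (phi := id)). Qed.

Lemma normle_weak (T : choiceType) (f : T -> R) c c' :
  c <= c' -> normle f c -> normle f c'.
Proof. by move=> cc h; apply: le_trans h _; rewrite lee_fin. Qed.

Lemma normle_coord (T : choiceType) (f : T -> R) c i : normle f c -> `|f i| <= c.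
Proof.
move=> hf; have c0 := normle_ge0 hf.
have [[r sE r1]|sE] := exponent_cases; last by move/normle_ooP: hf; apply.
move/(normle_seqP _ sE c0): hf => /(_ [:: i] isT); rewrite big_seq1.
apply: contraTT; rewrite -!ltNge => h.
by apply: gt0_ltr_powR; rewrite ?nnegrE//; lra.
Qed.

Lemma normle0 (T : choiceType) : normle (fun _ : T => 0) 0.
Proof.
have [[r sE r1]|sE] := exponent_cases; last by apply/normle_ooP; rewrite ?normr0.
apply/(normle_seqP _ sE) => // X uX; rewrite big1 ?powR_ge0// => i _.
by rewrite normr0 powR0//; apply: lt0r_neq0; lra.
Qed.

Lemma normle_eq0 (T : choiceType) (f : T -> R) : normle f 0 -> f = fun=> 0.
Proof.
by move=> h; apply/funext => i; apply/eqP; rewrite -normr_le0; exact: normle_coord.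
Qed.

Lemma normleZ (T : choiceType) (a : R) (f : T -> R) c :
  normle f c -> normle (fun i => a * f i) (`|a| * c).
Proof.
move=> hf; have c0 := normle_ge0 hf.
have ac0 : 0 <= `|a| * c by rewrite mulr_ge0.
have [[r sE r1]|sE] := exponent_cases; last first.
  apply/normle_ooP => // i; rewrite normrM ler_wpM2l//.
  by move/normle_ooP: hf; apply.
move/(normle_seqP _ sE c0): hf => hf.
apply/(normle_seqP _ sE ac0) => X uX; rewrite powRM//.
under eq_bigr do rewrite normrM powRM//.
by rewrite -mulr_sumr ler_wpM2l ?powR_ge0 ?hf.
Qed.

(** Minkowski's inequality, from the convexity of the r-th power applied to
    [(x + y) / (a + b)], a convex combination of [x / a] and [y / b]. *)
Lemma normleD (T : choiceType) (f g : T -> R) a b :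
  normle f a -> normle g b -> normle (fun i => f i + g i) (a + b).
Proof.
move=> hf hg; have a0 := normle_ge0 hf; have b0 := normle_ge0 hg.
have [[r sE r1]|sE] := exponent_cases; last first.
  apply/normle_ooP; rewrite ?addr_ge0// => i; rewrite (le_trans (ler_normD _ _))// lerD//;
    by [move/normle_ooP: hf; apply|move/normle_ooP: hg; apply].
have [a00|an0] := eqVneq a 0.
  move: hf; rewrite a00 => /normle_eq0 ->; rewrite add0r.
  by under [X in normle X]funext do rewrite add0r.
have [b00|bn0] := eqVneq b 0.
  move: hg; rewrite b00 => /normle_eq0 ->; rewrite addr0.
  by under [X in normle X]funext do rewrite addr0.
have ap : 0 < a by rewrite lt_def an0.
have bp : 0 < b by rewrite lt_def bn0.
have ab0 : 0 < a + b by lra.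
apply/(normle_seqP _ sE (ltW ab0)) => X uX.
move/(normle_seqP _ sE a0): hf => /(_ X uX) hf.
move/(normle_seqP _ sE b0): hg => /(_ X uX) hg.
have key x y : 0 <= x -> 0 <= y ->
  powR (x + y) r <= powR (a + b) r *
     (a / (a + b) * (powR x r / powR a r) + b / (a + b) * (powR y r / powR b r)).
  move=> x0 y0.
  have ht : 0 <= a / (a + b) <= 1.
    by rewrite divr_ge0 ?(ltW ab0)//= ler_pdivrMr//; lra.
  have t0 : Itv.spec (Itv.num_sem (R:=R)) (Itv.Real `[0%Z, 1%Z]) (a / (a + b)).
    by rewrite /= /Itv.num_sem /= realE in_itv/=; move/andP: ht => [-> ->].
  have := @convex_powR R r r1 (Itv.mk t0) (x / a) (y / b).
  rewrite !inE/= !in_itv/= !andbT !divr_ge0// => /(_ isT isT).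
  rewrite [X in powR X _ <= _ -> _]convRE [X in _ <= X -> _]convRE /=.
  have -> : unstable.onem (a / (a + b)) = b / (a + b).
    by rewrite /unstable.onem; field; lra.
  have -> : a / (a + b) * (x / a) + b / (a + b) * (y / b) = (x + y) / (a + b).
    by field; lra.
  rewrite !powRM ?invr_ge0 ?addr_ge0//.
  have inv z : 0 < z -> powR z^-1 r = (powR z r)^-1.
    by move=> z0; rewrite -[z^-1]powR_inv1 ?(ltW z0)// powRAC powR_inv1 ?powR_ge0.
  rewrite !inv// => h.
  by rewrite -ler_pdivrMl ?powR_gt0// [_^-1 * _]mulrC.
apply: (@le_trans _ _ (\sum_(i <- X) powR (a + b) r *
    (a / (a + b) * (powR `|f i| r / powR a r)
     + b / (a + b) * (powR `|g i| r / powR b r)))).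
  apply: ler_sum => i _; apply: le_trans (key _ _ _ _) => //.
  by apply: ge0_ler_powR; rewrite ?nnegrE ?addr_ge0 ?ler_normD//; lra.
rewrite -mulr_sumr -[leRHS]mulr1 ler_wpM2l ?powR_ge0//.
rewrite big_split/= -!mulr_sumr -!mulr_suml.
have -> : 1 = a / (a + b) * 1 + b / (a + b) * 1 by field; lra.
by rewrite lerD// ler_wpM2l ?divr_ge0 ?(ltW ab0)// ler_pdivrMr ?powR_gt0// mul1r.
Qed.

Lemma normle_sum (T : choiceType) (I : Type) (r : seq I) (f : I -> T -> R) (c : I -> R) :
  (forall k, normle (f k) (c k)) ->
  normle (fun i => \sum_(k <- r) f k i) (\sum_(k <- r) c k).
Proof.
move=> h; elim: r => [|k r IH].
  rewrite big_nil; under [X in normle X]funext do rewrite big_nil.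
  exact: normle0.
rewrite big_cons; under [X in normle X]funext do rewrite big_cons.
exact: normleD.
Qed.

Lemma normle_delta (T : choiceType) (i : T) : normle (fun j => (j == i)%:R) 1.
Proof.
have [[r sE r1]|sE] := exponent_cases; last first.
  by apply/normle_ooP => // j; case: eqP => _; rewrite ?normr1 ?normr0.
apply/(normle_seqP _ sE) => // X uX; rewrite powR1.
have r0 : r != 0 by apply: lt0r_neq0; lra.
apply: (@le_trans _ _ (\sum_(j <- X | j == i) 1)).
  rewrite [leRHS]big_mkcond; apply: ler_sum => j _.
  by case: eqP => _; rewrite ?normr1 ?powR1// normr0 powR0.
by rewrite big_const_seq iter_addr addr0 -/(count_mem i X) count_uniq_mem// lern1 leq_b1.
Qed.

(** The unit ball is closed under uniform limits: only finite truncations have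
    to be compared, and there the uniform norm controls the norm. *)
Lemma normle_lim (T : choiceType) (f : T -> R) c : 0 <= c ->
  (forall e, 0 < e -> exists2 g, normle g c & forall i, `|f i - g i| <= e) ->
  normle f c.
Proof.
move=> c0 h.
suff fin (X : seq T) : uniq X -> normle (fun i => if i \in X then f i else 0) c.
  have [[r sE r1]|sE] := exponent_cases.
    apply/(normle_seqP _ sE c0) => X uX; move: (fin _ uX).
    move=> /(normle_seqP _ sE c0)/(_ X uX); rewrite big_seq.
    by under eq_bigr => i -> do []; rewrite -big_seq.
  apply/normle_ooP => // i; move: (fin [:: i] isT) => /(normle_ooP _ sE c0)/(_ i).
  by rewrite inE eqxx.
move=> uX; pose n := (size X)%:R : R.
suff le_eps e : 0 < e -> normle (fun i => if i \in X then f i else 0) (c + e).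
  rewrite /normle; apply/lee_addgt0Pr => e e0.
  by rewrite -EFinD; exact: le_eps.
move=> e0; have n0 : 0 < n + 1 by rewrite ltr_pwDr.
have [g gc fg] := h (e / (n + 1)) (divr_gt0 e0 n0).
(* a multiple of the indicator of X, whose norm the triangle inequality bounds
   by e *)
pose d i := \sum_(k <- X) e / (n + 1) * (i == k)%:R.
have dn : normle d e.
  apply: (@normle_weak _ _ (\sum_(k <- X) `|e / (n + 1)| * 1)).
    rewrite big_const_seq iter_addr count_predT addr0 mulr1 -mulr_natr.
    rewrite ger0_norm ?divr_ge0 ?(ltW e0) ?(ltW n0)// -/n.
    by rewrite mulrAC ler_pdivrMr// ler_pM2l//; lra.
  by apply: normle_sum => k; apply: normleZ; apply: normle_delta.
have dE i : i \in X -> d i = e / (n + 1).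
  move=> iX; rewrite /d -mulr_sumr (bigD1_seq i)//= eqxx big1 ?addr0 ?mulr1// => j.
  by rewrite eq_sym => /negbTE ->.
have d0 i : 0 <= d i.
  by apply: sumr_ge0 => k _; rewrite mulr_ge0// divr_ge0 ?(ltW e0) ?(ltW n0).
have gabs : normle (fun i => `|g i|) c by apply: normle_mono gc => i; rewrite normr_id.
apply: normle_mono (normleD gabs dn) => i.
have gd : 0 <= `|g i| + d i by rewrite addr_ge0.
rewrite (ger0_norm gd); case: ifP => iX; last by rewrite normr0.
by have := fg i; rewrite dE//; have := ler_distD (g i) (f i) 0; rewrite !subr0; lra.
Qed.

(** Absorption arguments need the norm itself, as the least bound, to have
    the same quantity on both sides of an inequality. *)
Lemma normle_min (T : choiceType) (f : T -> R) c : normle f c ->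
  exists2 n, normle f n & forall c', normle f c' -> n <= c'.
Proof.
move=> h; have fin : lsnorm s (fun i => (f i)%:C) \is a fin_num.
  by rewrite ge0_fin_numE ?lsnorm_ge0//; apply: le_lt_trans h (ltry _).
exists (fine (lsnorm s (fun i => (f i)%:C))) => [|c']; rewrite /normle.
  by rewrite fineK.
by move=> hc; rewrite -lee_fin fineK.
Qed.

Lemma lspaceP (T : choiceType) (x : T -> R[i]) :
  lspace s x <-> exists c, normle (fun i => normc (x i)) c.
Proof.
split=> [h|[c h]]; last exact: le_lt_trans ((lsnorm_normle x c).2 h) (ltry c).
have fin : lsnorm s x \is a fin_num by rewrite ge0_fin_numE ?lsnorm_ge0.
by exists (fine (lsnorm s x)); apply: (lsnorm_normle _ _).1; rewrite fineK.
Qed.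

End SequenceNorm.

Arguments normle {R} s {T} f c.

(** * Geometric bounds, and nonnegative row-finite matrices *)

Lemma le_geometric0 (R : realType) (q K a : R) : 0 <= q < 1 ->
  (forall n, a <= K * q ^+ n) -> a <= 0.
Proof.
move=> /andP[q0 q1] h.
have cv : geometric K q @ \oo --> (0 : R) by apply: cvg_geometric; rewrite ger0_norm.
by apply: (cvgr_to_ge cv); near=> n; exact: h.
Unshelve. all: by end_near.
Qed.

Lemma geometric_lt (R : realType) (q K e : R) : 0 <= q < 1 -> 0 < e ->
  exists n0, forall n, (n0 <= n)%N -> K * q ^+ n < e.
Proof.
move=> /andP[q0 q1] e0.
have cv : geometric K q @ \oo --> (0 : R) by apply: cvg_geometric; rewrite ger0_norm.
have := cvgr_lt _ cv _ e0; rewrite nearE => -[n0 _ h].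
by exists n0 => n /h.
Qed.

Lemma geometric_tail (R : realType) (q : R) m n : 0 <= q < 1 -> (m <= n)%N ->
  \sum_(m <= k < n) q ^+ k <= q ^+ m / (1 - q).
Proof.
move=> /andP[q0 q1] mn; rewrite ler_pdivlMr ?subr_gt0//.
suff -> : (\sum_(m <= k < n) q ^+ k) * (1 - q) = q ^+ m - q ^+ n.
  by rewrite gerBl exprn_ge0.
rewrite mulrC -opprB mulNr mulrC mulr_suml.
under eq_bigr do rewrite mulrBr mulr1 -exprSr.
by rewrite telescope_sumr// opprB.
Qed.

(** The explicit remainder makes the convergence of the Neumann series
    uniform over the indices, which is what lets limits pass through rows
    and norms. *)
Lemma geometric_series_lim (R : realType) (u : nat -> R) (M q : R) : 0 <= q < 1 ->
  (forall k, `|u k| <= M * q ^+ k) ->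
  exists l, forall n, `|l - \sum_(0 <= k < n) u k| <= M * (q ^+ n / (1 - q)).
Proof.
move=> hq hu; have /andP[q0 q1] := hq.
have M0 : 0 <= M by have := hu 0%N; rewrite expr0 mulr1; apply: le_trans.
have cv : cvgn (series u).
  apply: normed_cvg; apply: (@series_le_cvg _ _ (geometric M q)) => //.
  - by move=> n; exact: normr_ge0.
  - by move=> n; rewrite /geometric/= mulr_ge0// exprn_ge0.
  - by apply: is_cvg_geometric_series; rewrite ger0_norm.
exists (limn (series u)) => n.
have cvn : (fun m => `|series u m - series u n|) @ \oo --> `|limn (series u) - series u n|.
  by apply: cvg_norm; apply: cvgB => //; exact: cvg_cst.
apply: (cvgr_to_le cvn); near=> m.
have nm : (n <= m)%N by near: m; exists n.
rewrite sub_series_geq//; apply: le_trans (ler_norm_sum _ _ _) _.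
apply: (@le_trans _ _ (\sum_(n <= k < m) M * q ^+ k)); first exact: ler_sum.
by rewrite -mulr_sumr ler_wpM2l// geometric_tail.
Unshelve. all: by end_near.
Qed.

Lemma normc_le_ReIm (R : realType) (z : R[i]) : normc z <= `|complex.Re z| + `|complex.Im z|.
Proof.
case: z => a b /=; rewrite -[leRHS]ger0_norm ?addr_ge0// -sqrtr_sqr ler_wsqrtr//.
rewrite sqrrD !real_normK ?num_real//.
by have := mulr_ge0 (normr_ge0 a) (normr_ge0 b); lra.
Qed.

Lemma Re_le_normc (R : realType) (z : R[i]) : `|complex.Re z| <= normc z.
Proof. by case: z => a b /=; rewrite -sqrtr_sqr ler_wsqrtr// lerDl sqr_ge0. Qed.

Lemma Im_le_normc (R : realType) (z : R[i]) : `|complex.Im z| <= normc z.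
Proof. by case: z => a b /=; rewrite -sqrtr_sqr ler_wsqrtr// lerDr sqr_ge0. Qed.

Lemma normc_sum (R : realType) (I : Type) (r : seq I) (F : I -> R[i]) :
  normc (\sum_(k <- r) F k) <= \sum_(k <- r) normc (F k).
Proof.
elim: r => [|k r IH]; first by rewrite !big_nil normc0.
by rewrite !big_cons; apply: le_trans (le_normcD _ _) _; rewrite lerD2l.
Qed.

Lemma normcX (R : realType) (z : R[i]) n : normc (z ^+ n) = normc z ^+ n.
Proof. by elim: n => [|n IH]; rewrite ?expr0 ?normc1// !exprS normcM IH. Qed.

Lemma ReD (R : realType) (x y : R[i]) : complex.Re (x + y) = complex.Re x + complex.Re y.
Proof. by case: x; case: y. Qed.

Lemma ImD (R : realType) (x y : R[i]) : complex.Im (x + y) = complex.Im x + complex.Im y.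
Proof. by case: x; case: y. Qed.

Lemma ReB (R : realType) (x y : R[i]) : complex.Re (x - y) = complex.Re x - complex.Re y.
Proof. by case: x; case: y. Qed.

Lemma ImB (R : realType) (x y : R[i]) : complex.Im (x - y) = complex.Im x - complex.Im y.
Proof. by case: x; case: y. Qed.

Lemma ReZ (R : realType) (a : R) (z : R[i]) : complex.Re (a%:C * z) = a * complex.Re z.
Proof. by case: z => x y /=; rewrite mul0r subr0. Qed.

Lemma ImZ (R : realType) (a : R) (z : R[i]) : complex.Im (a%:C * z) = a * complex.Im z.
Proof. by case: z => x y /=; rewrite mul0r addr0. Qed.

Lemma Re_sum (R : realType) (I : Type) (r : seq I) (F : I -> R[i]) :
  complex.Re (\sum_(k <- r) F k) = \sum_(k <- r) complex.Re (F k).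
Proof. by apply: (big_morph (@complex.Re R)) => // x y; exact: ReD. Qed.

Lemma Im_sum (R : realType) (I : Type) (r : seq I) (F : I -> R[i]) :
  complex.Im (\sum_(k <- r) F k) = \sum_(k <- r) complex.Im (F k).
Proof. by apply: (big_morph (@complex.Im R)) => // x y; exact: ImD. Qed.

Lemma nonneg_complexE (R : realType) (z : R[i]) : 0 <= z -> z = (complex.Re z)%:C /\ 0 <= complex.Re z.
Proof. by case: z => a b; rewrite lecE/= => /andP[/eqP -> ?]. Qed.

Section NonnegativeMatrix.
Context {R : realType} {T : choiceType}.
Variable A : T -> T -> R[i].
Hypothesis A_ge0 : forall i j, 0 <= A i j.
Hypothesis A_row : forall i, finite_set [set j | A i j != 0].

(** The action on real sequences. For a nonnegative matrix it bounds [mxop]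
    on moduli and describes it on real and imaginary parts, so that all
    comparisons take place in the ordered field R. *)
Definition rop (f : T -> R) : T -> R :=
  fun i => \sum_(j \in [set: T]) complex.Re (A i j) * f j.

(** One list serves for all vectors, which reduces linearity and
    monotonicity of the row sums to finite sums. *)
Lemma row_seq i : exists r : seq T, [/\ forall j, (j \in r) = (A i j != 0),
  forall x, mxop A x i = \sum_(j <- r) A i j * x j &
  forall f, rop f i = \sum_(j <- r) complex.Re (A i j) * f j].
Proof.
exists (finmap.enum_fset (fset_set [set j | A i j != 0])).
have mem j : (j \in finmap.enum_fset (fset_set [set j | A i j != 0])) = (A i j != 0).
  by rewrite [LHS](in_fset_set (A_row i)); apply/idP/idP; rewrite inE.
split=> // [x|f]; apply: fsbigTE => j jn.
  suff -> : A i j = 0 by rewrite mul0r.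
  by apply/eqP; rewrite -[_ == _]negbK -mem.
suff -> : A i j = 0 by rewrite mul0r.
by apply/eqP; rewrite -[_ == _]negbK -mem.
Qed.

Lemma Re_ge0 i j : 0 <= complex.Re (A i j).
Proof. by have [] := nonneg_complexE (A_ge0 i j). Qed.

Lemma mxopD x y i : mxop A (fun j => x j + y j) i = mxop A x i + mxop A y i.
Proof.
have [r [_ E _]] := row_seq i; rewrite !E -big_split.
by apply: eq_bigr => j _; rewrite mulrDr.
Qed.

Lemma mxopZ a x i : mxop A (fun j => a * x j) i = a * mxop A x i.
Proof.
have [r [_ E _]] := row_seq i; rewrite !E mulr_sumr.
by apply: eq_bigr => j _; rewrite mulrCA.
Qed.

Lemma mxopB x y i : mxop A (fun j => x j - y j) i = mxop A x i - mxop A y i.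
Proof.
rewrite (mxopD x (fun j => - y j)) -mulN1r -mxopZ; congr (_ + mxop A _ i).
by apply/funext => j; rewrite mulN1r.
Qed.

Lemma mxop_sum (I : Type) (r : seq I) (x : I -> T -> R[i]) i :
  mxop A (fun j => \sum_(k <- r) x k j) i = \sum_(k <- r) mxop A (x k) i.
Proof.
have [s [_ E _]] := row_seq i; rewrite E; under [RHS]eq_bigr do rewrite E.
by rewrite exchange_big; apply: eq_bigr => j _; rewrite mulr_sumr.
Qed.

Lemma ropD f g i : rop (fun j => f j + g j) i = rop f i + rop g i.
Proof.
have [r [_ _ E]] := row_seq i; rewrite !E -big_split.
by apply: eq_bigr => j _; rewrite mulrDr.
Qed.

Lemma ropZ a f i : rop (fun j => a * f j) i = a * rop f i.
Proof.
have [r [_ _ E]] := row_seq i; rewrite !E mulr_sumr.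
by apply: eq_bigr => j _; rewrite mulrCA.
Qed.

Lemma ropN f i : rop (fun j => - f j) i = - rop f i.
Proof.
by rewrite -mulN1r -ropZ; congr (rop _ i); apply/funext => j; rewrite mulN1r.
Qed.

Lemma ropB f g i : rop (fun j => f j - g j) i = rop f i - rop g i.
Proof. by rewrite ropD ropN. Qed.

Lemma rop_le f g i : (forall j, A i j != 0 -> f j <= g j) -> rop f i <= rop g i.
Proof.
move=> fg; have [r [mem _ E]] := row_seq i; rewrite !E big_seq [leRHS]big_seq.
by apply: ler_sum => j jr; rewrite ler_wpM2l ?Re_ge0 ?fg -?mem.
Qed.

Lemma rop_ge0 f i : (forall j, A i j != 0 -> 0 <= f j) -> 0 <= rop f i.
Proof.
move=> f0; have [r [mem _ E]] := row_seq i; rewrite !E big_seq.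
by apply: sumr_ge0 => j jr; rewrite mulr_ge0 ?Re_ge0 ?f0 -?mem.
Qed.

Lemma eq_rop f g i : (forall j, A i j != 0 -> f j = g j) -> rop f i = rop g i.
Proof.
by move=> fg; apply/eqP; rewrite eq_le !rop_le// => j /fg ->.
Qed.

Lemma rop_eq0 f i : (forall j, A i j != 0 -> f j = 0) -> rop f i = 0.
Proof.
move=> f0; have [r [mem _ E]] := row_seq i; rewrite E big_seq big1// => j jr.
by rewrite f0 ?mulr0 -?mem.
Qed.

Lemma eq_mxop x y i : (forall j, A i j != 0 -> x j = y j) -> mxop A x i = mxop A y i.
Proof.
move=> xy; have [r [mem E _]] := row_seq i; rewrite !E.
by apply: eq_big_seq => j jr; rewrite xy -?mem.
Qed.

Lemma normc_mxop x i : normc (mxop A x i) <= rop (fun j => normc (x j)) i.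
Proof.
have [r [_ E1 E2]] := row_seq i; rewrite E1 E2; apply: le_trans (normc_sum _ _) _.
apply: ler_sum => j _; have [-> a0] := nonneg_complexE (A_ge0 i j).
by rewrite normcM normc_real ger0_norm.
Qed.

Lemma Re_mxop x i : complex.Re (mxop A x i) = rop (fun j => complex.Re (x j)) i.
Proof.
have [r [_ E1 E2]] := row_seq i; rewrite E1 E2 Re_sum; apply: eq_bigr => j _.
have [-> _] := nonneg_complexE (A_ge0 i j).
by case: (x j) => a b /=; rewrite mul0r subr0.
Qed.

Lemma Im_mxop x i : complex.Im (mxop A x i) = rop (fun j => complex.Im (x j)) i.
Proof.
have [r [_ E1 E2]] := row_seq i; rewrite E1 E2 Im_sum; apply: eq_bigr => j _.
have [-> _] := nonneg_complexE (A_ge0 i j).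
by case: (x j) => a b /=; rewrite mul0r addr0.
Qed.

Lemma mxop_real f i : mxop A (fun j => (f j)%:C) i = (rop f i)%:C.
Proof.
apply/eqP; rewrite eq_complex Re_mxop Im_mxop/= eqxx/=; apply/eqP.
by have [r [_ _ E]] := row_seq i; rewrite E big1// => j _; rewrite mulr0.
Qed.

Lemma iter_mxop_real k f :
  iter k (mxop A) (fun j => (f j)%:C) = (fun j => (iter k rop f j)%:C).
Proof. by elim: k => //= k ->; apply/funext => i; rewrite mxop_real. Qed.

Lemma iter_rop_le k f g : (forall i, f i <= g i) -> forall i, iter k rop f i <= iter k rop g i.
Proof. by move=> fg; elim: k => //= k IH i; apply: rop_le. Qed.

Lemma iter_rop_ge0 k f : (forall i, 0 <= f i) -> forall i, 0 <= iter k rop f i.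
Proof. by move=> f0; elim: k => //= k IH i; apply: rop_ge0. Qed.

Lemma iter_ropD k f g : iter k rop (fun j => f j + g j) = (fun j => iter k rop f j + iter k rop g j).
Proof. by elim: k => //= k ->; apply/funext => i; rewrite ropD. Qed.

Lemma iter_ropZ k a f : iter k rop (fun j => a * f j) = (fun j => a * iter k rop f j).
Proof. by elim: k => //= k ->; apply/funext => i; rewrite ropZ. Qed.

Lemma normc_iter_mxop k x i :
  normc (iter k (mxop A) x i) <= iter k rop (fun j => normc (x j)) i.
Proof.
elim: k i => //= k IH i; apply: le_trans (normc_mxop _ _) _.
by apply: rop_le.
Qed.

End NonnegativeMatrix.

(** * Maximum principle and Neumann series *)

Section PowerBounded.
Context {R : realType} {s : \bar R}.
Hypothesis hs : (1 <= s)%E.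
Context {T : choiceType}.
Variable A : T -> T -> R[i].
Hypothesis A_ge0 : forall i j, 0 <= A i j.
Hypothesis A_row : forall i, finite_set [set j | A i j != 0].

Local Notation P := (rop A).

(** Everything below follows from such a geometric bound for the powers, by
    whatever constants; the spectral radius only serves to provide one. *)
Definition power_bounded (K lam : R) : Prop :=
  [/\ 0 <= K, 0 <= lam & forall k f c, normle s f c ->
       normle s (iter k P f) (K * lam ^+ k * c)].

Lemma power_bounded_le K lam lam' :
  lam <= lam' -> power_bounded K lam -> power_bounded K lam'.
Proof.
move=> ll [K0 l0 h]; split=> // [|k f c fc]; first exact: le_trans ll.
apply: normle_weak (h k f c fc); rewrite ler_wpM2r ?(normle_ge0 fc)//.
by rewrite ler_wpM2l// lerXn2r ?nnegrE//; exact: le_trans ll.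
Qed.

(** The positive part of [d] is dominated by [t P] applied to itself, hence
    by all its iterates, whose norms tend to 0. *)
Lemma maximum_principle K lam t d c : power_bounded K lam ->
  0 <= t -> t * lam < 1 -> normle s d c ->
  (forall i, d i <= 0 \/ d i <= t * P d i) -> forall i, d i <= 0.
Proof.
move=> [K0 l0 pb] t0 tl dc hd.
pose p i := Num.max 0 (d i).
have p0 i : 0 <= p i by rewrite le_max lexx.
have pc : normle s p c.
  apply: (normle_mono hs) dc => i; rewrite /p.
  by case: (lerP 0 (d i)) => h; rewrite ?normr0// ger0_norm.
have dp i : d i <= p i by rewrite le_max lexx orbT.
have step i : p i <= t * P p i.
  have Pp0 : 0 <= P p i by apply: rop_ge0.
  rewrite ge_max mulr_ge0//=; have [di|di] := hd i.
    by apply: le_trans di _; rewrite mulr_ge0.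
  by apply: le_trans di _; rewrite ler_wpM2l//; apply: rop_le.
have iterp k i : p i <= t ^+ k * iter k P p i.
  elim: k i => [|k IH] i; first by rewrite expr0 mul1r.
  apply: le_trans (step i) _; rewrite exprS -mulrA ler_wpM2l// iterS -ropZ//.
  by apply: rop_le.
move=> i; apply: le_trans (dp i) _.
apply: (@le_geometric0 _ (t * lam) (K * c)) => [|k]; first by rewrite mulr_ge0.
apply: le_trans (iterp k i) _; rewrite exprMn.
have := normle_coord hs i (pb k p c pc).
rewrite ger0_norm ?iter_rop_ge0// => h.
by apply: le_trans (ler_wpM2l (exprn_ge0 k t0) h) _; rewrite le_eqVlt; apply/orP; left; apply/eqP; ring.
Qed.

(** The partial sums [S n] of the Neumann series converge uniformly over the
    indices, so both the equation and, by [normle_lim], the bound pass to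
    the limit. *)
Lemma neumann_solution K lam tau x c : power_bounded K lam ->
  normc tau * lam < 1 -> normle s (fun i => normc (x i)) c ->
  exists2 y, normle s (fun i => normc (y i)) (K / (1 - normc tau * lam) * c) &
    forall i, y i = x i + tau * mxop A y i.
Proof.
move=> [K0 l0 pb] q1 xc; set q := normc tau * lam.
have c0 := normle_ge0 xc.
have q0 : 0 <= q by rewrite mulr_ge0// normc_ge0.
have hq : 0 <= q < 1 by rewrite q0.
pose term k i := tau ^+ k * iter k (mxop A) x i.
pose S n i := \sum_(0 <= k < n) term k i.
have t0 : 0 <= normc tau by exact: normc_ge0.
have SS n i : S n.+1 i = x i + tau * mxop A (S n) i.
  rewrite /S big_nat_recl// /term expr0 mul1r/=; congr (_ + _).
  rewrite mxop_sum// mulr_sumr; apply: eq_bigr => k _.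
  by rewrite mxopZ// exprS mulrA.
have term_norm k : normle s (fun i => normc (term k i)) (K * q ^+ k * c).
  have := normleZ hs (normc tau ^+ k) (pb k _ _ xc).
  rewrite ger0_norm ?exprn_ge0//.
  have -> : normc tau ^+ k * (K * lam ^+ k * c) = K * q ^+ k * c.
    by rewrite /q exprMn; ring.
  apply: (normle_mono hs) => i; rewrite !ger0_norm ?normc_ge0 ?mulr_ge0 ?exprn_ge0//;
    last by apply: iter_rop_ge0 => // j; rewrite normc_ge0.
  by rewrite /term normcM normcX ler_wpM2l ?exprn_ge0// normc_iter_mxop.
have term_le k i : normc (term k i) <= K * c * q ^+ k.
  have := normle_coord hs i (term_norm k); rewrite ger0_norm ?normc_ge0//.
  by rewrite mulrAC.
have S_norm n : normle s (fun i => normc (S n i)) (K / (1 - q) * c).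
  apply: (@normle_weak _ _ _ _ (\sum_(0 <= k < n) K * q ^+ k * c)).
    rewrite -mulr_suml ler_wpM2r// -mulr_sumr ler_wpM2l//.
    by have := geometric_tail hq (leq0n n); rewrite expr0 div1r.
  apply: (normle_mono hs) (normle_sum hs (index_iota 0 n) term_norm) => i.
  rewrite !ger0_norm ?normc_ge0 ?sumr_ge0// => [|k _]; last exact: normc_ge0.
  exact: normc_sum.
pose M := K * c.
have lim i : exists l, forall n, normc (l - S n i) <= 2 * M / (1 - q) * q ^+ n.
  have [a ha] : exists a, forall n,
      `|a - \sum_(0 <= k < n) complex.Re (term k i)| <= M * (q ^+ n / (1 - q)).
    apply: geometric_series_lim => // k.
    exact: le_trans (Re_le_normc _) (term_le k i).
  have [b hb] : exists b, forall n,
      `|b - \sum_(0 <= k < n) complex.Im (term k i)| <= M * (q ^+ n / (1 - q)).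
    apply: geometric_series_lim => // k.
    exact: le_trans (Im_le_normc _) (term_le k i).
  exists (a +i* b)%C => n; apply: le_trans (normc_le_ReIm _) _.
  have -> : complex.Re ((a +i* b)%C - S n i) = a - \sum_(0 <= k < n) complex.Re (term k i).
    by rewrite ReB /S Re_sum.
  have -> : complex.Im ((a +i* b)%C - S n i) = b - \sum_(0 <= k < n) complex.Im (term k i).
    by rewrite ImB /S Im_sum.
  have -> : 2 * M / (1 - q) * q ^+ n = M * (q ^+ n / (1 - q)) + M * (q ^+ n / (1 - q)).
    by field; rewrite subr_eq0 gt_eqF.
  exact: lerD.
have [y hy] := choice lim.
have C0 : 0 <= 2 * M / (1 - q).
  by rewrite divr_ge0 ?subr_ge0 ?(ltW q1)// mulr_ge0// mulr_ge0.
exists y => [|i].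
  apply: (normle_lim hs); first by rewrite mulr_ge0// divr_ge0// subr_ge0 ltW.
  move=> e e0; have [n hn] := geometric_lt (2 * M / (1 - q)) hq e0.
  exists (fun i => normc (S n i)) => // i.
  apply: le_trans (_ : normc (y i - S n i) <= e); last first.
    exact: le_trans (hy i n) (ltW (hn n (leqnn n))).
  have h1 : normc (y i) <= normc (y i - S n i) + normc (S n i).
    by rewrite -{1}(subrK (S n i) (y i)) le_normcD.
  have h2 : normc (S n i) <= normc (y i - S n i) + normc (y i).
    by rewrite -{1}(subrK (y i) (S n i)) -[normc (y i - _)]normcN opprB le_normcD.
  by rewrite ler_norml; apply/andP; split; lra.
(* the defect of y in row i is bounded by the errors of S n and S n.+1, for
   every n *)
apply/eqP; rewrite -subr_eq0; apply/eqP/eq0_normc/eqP; rewrite eq_le normc_ge0 andbT.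
have [r [_ Er _]] := row_seq A_row i.
pose N := \sum_(j <- r) normc (A i j).
apply: (@le_geometric0 _ q (2 * M / (1 - q) * (q + normc tau * N))) => // n.
have -> : y i - (x i + tau * mxop A y i)
    = (y i - S n.+1 i) - tau * mxop A (fun j => y j - S n j) i.
  by rewrite mxopB// SS; ring.
apply: le_trans (le_normcD _ _) _; rewrite normcN normcM mulrDr mulrDl.
apply: lerD.
  by apply: le_trans (hy i n.+1) _; rewrite exprS mulrA.
have -> : 2 * M / (1 - q) * (normc tau * N) * q ^+ n
    = normc tau * (N * (2 * M / (1 - q) * q ^+ n)) by ring.
rewrite Er ler_wpM2l// /N mulr_suml; apply: le_trans (normc_sum _ _) _.
by apply: ler_sum => j _; rewrite normcM ler_wpM2l ?normc_ge0.
Qed.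

(** The maximum principle for the modulus of the difference. *)
Lemma neumann_unique K lam tau y z : power_bounded K lam ->
  normc tau * lam < 1 -> lspace s y -> lspace s z ->
  (forall i, y i - tau * mxop A y i = z i - tau * mxop A z i) -> y = z.
Proof.
move=> pb q1 /lspaceP[c yc] /lspaceP[c' zc] E.
have dc : normle s (fun i => normc (y i - z i)) (c + c').
  apply: (normle_mono hs) (normleD hs yc zc) => i.
  rewrite !ger0_norm ?addr_ge0 ?normc_ge0//.
  by apply: le_trans (le_normcD _ _) _; rewrite normcN.
have t0 : 0 <= normc tau by exact: normc_ge0.
apply/funext => i; apply/eqP; rewrite -subr_eq0; apply/eqP/eq0_normc/eqP.
rewrite eq_le normc_ge0 andbT.
apply: (maximum_principle pb t0 q1 dc) => {}i; right.
have -> : y i - z i = tau * mxop A (fun j => y j - z j) i.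
  rewrite mxopB//.
  by have := E i => /(congr1 (fun w => w + tau * mxop A y i - z i)); rewrite subrK => ->; ring.
by rewrite normcM ler_wpM2l// normc_mxop.
Qed.

Lemma opnorm_le (U : choiceType) (F : (T -> R[i]) -> (U -> R[i])) C :
  (forall x, normle s (fun i => normc (x i)) 1 -> normle s (fun i => normc (F x i)) C) ->
  (opnorm s F <= C%:E)%E.
Proof.
move=> h; apply: ge_ereal_sup => _ [x x1 <-].
by apply: (lsnorm_normle _ _).2; apply: h; apply: (lsnorm_normle _ _).1.
Qed.

Lemma opnorm_bound (U : choiceType) (F : (T -> R[i]) -> (U -> R[i])) b :
  (forall a x i, lspace s x -> F (fun j => a * x j) i = a * F x i) ->
  0 <= b -> (opnorm s F <= b%:E)%E ->
  forall x c, normle s (fun i => normc (x i)) c -> normle s (fun i => normc (F x i)) (b * c).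
Proof.
move=> FZ b0 Fb x c xc; have c0 := normle_ge0 xc.
have lx : lspace s x by apply/lspaceP; exists c.
have [cz|cn0] := eqVneq c 0.
  rewrite cz in xc *; have x0 := normle_eq0 hs xc.
  have Fx0 i : F x i = 0.
    rewrite -[RHS](mul0r (F x i)) -FZ//; congr (F _ i); apply/funext => j.
    by rewrite mul0r; apply: eq0_normc; exact: (congr1 (@^~ j) x0).
  rewrite mulr0; under [X in normle s X]funext do rewrite Fx0 normc0.
  exact: normle0.
have cp : 0 < c by rewrite lt_def cn0.
have ci : normc ((c^-1)%:C : R[i]) = c^-1 by rewrite normc_real ger0_norm ?invr_ge0.
have x1 : normle s (fun i => normc ((c^-1)%:C * x i)) 1.
  have := normleZ hs c^-1 xc; rewrite ger0_norm ?invr_ge0// mulVf//.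
  by apply: (normle_mono hs) => i; rewrite normcM ci.
have Fx1 : normle s (fun i => normc (F (fun j => (c^-1)%:C * x j) i)) b.
  apply: (lsnorm_normle _ _).1; apply: le_trans Fb; apply: ereal_sup_ubound.
  by exists (fun j => (c^-1)%:C * x j) => //; apply: (lsnorm_normle _ _).2.
have := normleZ hs c Fx1; rewrite ger0_norm// [c * b]mulrC.
apply: (normle_mono hs) => i; rewrite FZ// normcM ci mulrA mulfV// mul1r.
by rewrite ger0_norm ?normc_ge0.
Qed.

Lemma bounded_op_bound (F : (T -> R[i]) -> (T -> R[i])) : bounded_op s F ->
  exists2 b, 0 <= b & forall x c,
    normle s (fun i => normc (x i)) c -> normle s (fun i => normc (F x i)) (b * c).
Proof.
move=> [Flin Foo].
have l0 : lspace s (fun _ : T => 0 : R[i]).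
  apply/lspaceP; exists 0; under [X in normle s X]funext do rewrite normc0.
  exact: normle0.
have F0 : F 0 = 0.
  have := Flin 1 0 0 l0 l0; rewrite scale1r addr0 scale1r => /(congr1 (fun w => w - F 0)).
  by rewrite addrK subrr.
have op0 : (0 <= opnorm s F)%E.
  apply: le_trans (lsnorm_ge0 _) (ereal_sup_ubound _); exists 0 => //=.
  apply: (lsnorm_normle _ _).2; under [X in normle s X]funext do rewrite normc0.
  exact: normle_weak ler01 (normle0 hs _).
have fin : opnorm s F \is a fin_num by rewrite ge0_fin_numE.
exists (fine (opnorm s F)); first exact: fine_ge0.
apply: opnorm_bound; rewrite ?fineK ?fine_ge0// => a x i lx.
have := Flin a x 0 lx l0; rewrite F0 !addr0 => /(congr1 (@^~ i)) E.
exact: E.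
Qed.

(** Choosing a solution for every right-hand side gives an operator; it is
    linear because solutions are unique. *)
Lemma neumann_inverse K lam tau : power_bounded K lam -> normc tau * lam < 1 ->
  exists G, inverse_op s (fun x => x - tau *: mxop A x) G.
Proof.
move=> pb q1; have [K0 l0 _] := pb.
have q0 : 0 <= normc tau * lam by rewrite mulr_ge0// normc_ge0.
set C := K / (1 - normc tau * lam).
have C0 : 0 <= C by rewrite divr_ge0// subr_ge0 ltW.
have solve x : exists y, lspace s x ->
    (forall c, normle s (fun i => normc (x i)) c -> normle s (fun i => normc (y i)) (C * c))
    /\ forall i, y i = x i + tau * mxop A y i.
  have [/lspaceP[c xc]|nx] := pselect (lspace s x); last by exists 0 => /nx.
  have [n xn nmin] := normle_min xc.
  have [y yn Ey] := neumann_solution pb q1 xn; exists y => _; split=> // c' xc'.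
  by apply: normle_weak yn; rewrite ler_wpM2l// nmin.
have [G hG] := choice solve.
have lG x : lspace s x -> lspace s (G x).
  move=> lx; have [/(_ _ _) hn _] := hG x lx.
  by have /lspaceP[c xc] := lx; apply/lspaceP; exists (C * c); exact: hn.
have uniq x y : lspace s x -> lspace s y ->
    (forall i, y i - tau * mxop A y i = x i) -> G x = y.
  move=> lx ly Ey; apply: (neumann_unique pb q1) => //; first exact: lG.
  by move=> i; rewrite Ey; have [_ ->] := hG x lx; rewrite addrK.
have lin (a : R[i]) x y : lspace s x -> lspace s y -> lspace s (a *: x + y).
  move=> /lspaceP[c xc] /lspaceP[c' yc]; apply/lspaceP.
  exists (normc a * c + c').
  have := normleD hs (normleZ hs (normc a) xc) yc.
  rewrite ger0_norm ?normc_ge0//; apply: (normle_mono hs) => i.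
  rewrite !ger0_norm ?addr_ge0 ?mulr_ge0 ?normc_ge0//.
  by apply: le_trans (le_normcD _ _) _; rewrite normcM.
exists G; split; first split.
- move=> a x y lx ly; apply: uniq; first exact: lin.
    by apply: lin; exact: lG.
  move=> i.
  have -> : mxop A (a *: G x + G y) i = a * mxop A (G x) i + mxop A (G y) i.
    by rewrite -mxopZ// -mxopD.
  have [_ Ex] := hG x lx; have [_ Ey] := hG y ly.
  rewrite -[(a *: G x + G y) i]/(a * G x i + G y i) -[(a *: x + y) i]/(a * x i + y i).
  by rewrite {1}Ex {1}Ey; ring.
- apply: le_lt_trans (opnorm_le (C := C) _) (ltry _) => x x1.
  have lx : lspace s x by apply/lspaceP; exists 1.
  by have [h _] := hG x lx; rewrite -[C]mulr1; exact: h.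
- move=> x lx; split; last first.
    apply/funext => i; have [_ E] := hG x lx.
    by rewrite -[LHS]/(G x i - tau * mxop A (G x) i) {1}E addrK.
  apply: uniq => //; have /lspaceP[c xc] := lx; have [_ _ pb1] := pb.
  apply/lspaceP; exists (c + normc tau * (K * lam ^+ 1 * c)).
  have := normleD hs xc (normleZ hs (normc tau) (pb1 1%N _ _ xc)).
  rewrite ger0_norm ?normc_ge0//; apply: (normle_mono hs) => i.
  have P0 : 0 <= P (fun i => normc (x i)) i by apply: rop_ge0 => // j _; exact: normc_ge0.
  rewrite !ger0_norm ?addr_ge0 ?mulr_ge0 ?normc_ge0//.
  apply: le_trans (le_normcD _ _) _; rewrite lerD2l normcN normcM ler_wpM2l ?normc_ge0//.
  exact: (normc_iter_mxop A_ge0 A_row 1 x i).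
Qed.

End PowerBounded.

Arguments power_bounded {R} s {T} A K lam.

(** * Growth of the powers and the spectral radius *)

Section SpectralRadius.
Context {R : realType} {s : \bar R}.
Hypothesis hs : (1 <= s)%E.
Context {T : choiceType}.
Variable A : T -> T -> R[i].
Hypothesis A_ge0 : forall i j, 0 <= A i j.
Hypothesis A_row : forall i, finite_set [set j | A i j != 0].
Hypothesis A_bounded : bounded_op s (mxop A).

Local Notation P := (rop A).
Local Notation rho := (spectral_radius s (mxop A)).

Lemma power_bounded_norm : exists2 b, 0 < b & power_bounded s A 1 b.
Proof.
have [b b0 hb] := bounded_op_bound hs A_bounded.
exists (b + 1); first by rewrite ltr_pwDr.
suff pb : power_bounded s A 1 b by apply: power_bounded_le pb; rewrite lerDl.
split=> // k f c fc; elim: k => [|k IH]; first by rewrite expr0 !mul1r.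
have g1 : normle s (fun i => normc ((iter k P f i)%:C : R[i])) (1 * b ^+ k * c).
  by apply: (normle_mono hs) IH => i; rewrite normc_real normr_id.
have := hb _ _ g1; rewrite exprS !mul1r mulrA; apply: (normle_mono hs) => i.
by rewrite iterS mxop_real// normc_real normr_id.
Qed.

(** Needed because the supremum of an unbounded set of reals is a default
    value, which says nothing about the set. The reason is the Neumann
    series for [z^-1 A]. *)
Lemma spectrum_bounded : exists b, forall z, spectrum s (mxop A) z -> normc z <= b.
Proof.
have [b b0 pb] := power_bounded_norm.
exists b => z zs; rewrite leNgt; apply/negP => bz; apply: zs.
have z0 : 0 < normc z by apply: lt_trans bz.
have zn0 : z != 0 by apply: contraTneq z0 => ->; rewrite normc0 ltxx.
have q1 : normc z^-1 * b < 1.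
  by rewrite normcV mulrC ltr_pdivrMr// mul1r.
have [G [[Glin Goo] GK]] := neumann_inverse hs A_ge0 A_row pb q1.
have lz (a : R[i]) (x : T -> R[i]) : lspace s x -> lspace s (a *: x).
  move=> /lspaceP[c xc]; apply/lspaceP; exists (normc a * c).
  have := normleZ hs (normc a) xc; rewrite ger0_norm ?normc_ge0//.
  by apply: (normle_mono hs) => i; rewrite normcM ger0_norm ?mulr_ge0 ?normc_ge0.
have [c c0 hc] := bounded_op_bound hs (conj Glin Goo).
exists (fun x => G (z^-1 *: x)); split; first split.
- move=> a x y lx ly; rewrite -Glin; try exact: lz.
  by rewrite scalerDr !scalerA mulrC.
- apply: le_lt_trans (opnorm_le (C := c * (normc z^-1 * 1)) _) (ltry _) => x x1.
  apply: hc; have := normleZ hs (normc z^-1) x1.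
  rewrite ger0_norm ?normc_ge0//; apply: (normle_mono hs) => i.
  by rewrite normcM ger0_norm ?mulr_ge0 ?normc_ge0.
move=> x lx; split.
  have [E _] := GK x lx; rewrite -[RHS]E; congr (G _).
  by rewrite scalerBr scalerA mulVf// scale1r.
have [_ E] := GK _ (lz z^-1 x lx).
have := congr1 (fun w => z *: w) E.
by rewrite /= scalerBr !scalerA mulfV// !scale1r.
Qed.

Lemma spectral_radius_ge0 : 0 <= rho.
Proof.
rewrite /spectral_radius; set S := [set normc z | z in _].
have [[x Sx]|Se] := pselect (S !=set0).
  have ub : has_ubound S.
    by have [b hb] := spectrum_bounded; exists b => _ [z zs <-]; exact: hb.
  apply: le_trans (ub_le_sup ub Sx).
  by case: Sx => z _ <-; exact: normc_ge0.
have -> : S = set0 by apply/eqP; apply/negPn/negP => /set0P.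
by rewrite sup0.
Qed.

(** The two halves of invertibility in terms of real sequences: solvability
    with a bound, by taking real parts, and an a priori bound. *)
Lemma resolvent_real lam : rho < lam -> exists2 K, 0 < K &
  (forall f c, normle s f c -> exists2 z, normle s z (K * c) &
     forall i, lam * z i = P z i + f i) /\
  (forall v c c', normle s v c' -> normle s (fun i => lam * v i - P v i) c ->
     normle s v (K * c)).
Proof.
move=> rl; have l0 : 0 < lam by apply: le_lt_trans rl; exact: spectral_radius_ge0.
have [G [Gb GK]] : exists G, inverse_op s (fun x => lam%:C *: x - mxop A x) G.
  apply: contrapT => nz.
  have : spectrum s (mxop A) lam%:C by [].
  move=> zs; move: rl; apply/negP; rewrite -leNgt.
  rewrite -{1}(ger0_norm (ltW l0)) -normc_real.
  apply: ub_le_sup; last by exists lam%:C.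
  by have [b hb] := spectrum_bounded; exists b => _ [z zz <-]; exact: hb.
have [b b0 hb] := bounded_op_bound hs Gb.
have real_norm (f : T -> R) c : normle s f c -> normle s (fun i => normc ((f i)%:C : R[i])) c.
  by apply: (normle_mono hs) => i; rewrite normc_real normr_id.
have le_b1 c : 0 <= c -> b * c <= (b + 1) * c by move=> c0; rewrite ler_wpM2r// lerDl.
exists (b + 1); first by rewrite ltr_pwDr.
split=> [f c fc|v c c' vc' wc].
  have lf : lspace s (fun i => (f i)%:C) by apply/lspaceP; exists c; exact: real_norm.
  have [_ E] := GK _ lf.
  exists (fun i => complex.Re (G (fun i => (f i)%:C) i)) => [|i].
    apply: normle_weak (le_b1 _ (normle_ge0 fc)) _.
    apply: (normle_mono hs) (hb _ _ (real_norm _ _ fc)) => i.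
    by rewrite [leRHS]ger0_norm ?normc_ge0 ?Re_le_normc.
  set y := G _ in E *.
  have E' : complex.Re (lam%:C * y i - mxop A y i) = f i.
    exact: (congr1 (fun w => complex.Re (w i)) E).
  by rewrite -E' ReB ReZ Re_mxop// addrC subrK.
have lv : lspace s (fun i => (v i)%:C) by apply/lspaceP; exists c'; exact: real_norm.
have [E _] := GK _ lv.
apply: normle_weak (le_b1 _ (normle_ge0 wc)) _.
apply: (normle_mono hs) (hb _ _ (real_norm _ _ wc)) => i.
have -> : (fun i => (lam * v i - P v i)%:C) =
    lam%:C *: (fun i => (v i)%:C) - mxop A (fun i => (v i)%:C).
  apply/funext => j; rewrite -[RHS]/(lam%:C * (v j)%:C - mxop A _ j) mxop_real//.
  by rewrite rmorphB rmorphM.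
by rewrite E normc_real normr_id.
Qed.

(** Suppose that [mu1 < mu = l + e] is a growth rate and that [l - P]
    satisfies an a priori bound. The negative part [y] of [z] satisfies [l'
    y <= P y] for [l' = l - e]; so, with [B = P / mu] and [S N] the sum of
    [B^k y] over [k < N], one has [y <= B^N y + (2 e / mu) S N]. Since [(l -
    P) (S N) = mu (y - B^N y) - e (S N)], the a priori bound controls the
    norm of [S N] by those of [y] and [B^N y]; for small [e] the norm of [y]
    is absorbed, and [B^N y] tends to 0. Hence [y = 0]. *)
Lemma resolvent_positive l K0 K1 e mu1 f z c :
  0 < K0 -> 0 < e -> e < l -> 8 * e * K0 <= 1 ->
  mu1 < l + e -> power_bounded s A K1 mu1 ->
  (forall v c c', normle s v c' -> normle s (fun i => l * v i - P v i) c ->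
     normle s v (K0 * c)) ->
  normle s z c -> (forall i, 0 <= f i) ->
  (forall i, (l - e) * z i = P z i + f i) -> forall i, 0 <= z i.
Proof.
move=> K00 e0 el eK mul pb resol zc f0 Ez.
have [K10 mu10 pb1] := pb.
pose mu := l + e; have mu0 : 0 < mu by rewrite /mu; lra.
pose y i := Num.max 0 (- z i).
have y0 i : 0 <= y i by rewrite le_max lexx.
have zy i : - z i <= y i by rewrite le_max lexx orbT.
have yc' : normle s y c.
  apply: (normle_mono hs) zc => i; rewrite /y.
  by case: (lerP 0 (- z i)) => h; rewrite ?normr0// normrN.
have sub i : (l - e) * y i <= P y i.
  have Py0 : 0 <= P y i by apply: rop_ge0.
  rewrite /y; case: (lerP 0 (- z i)) => h; last by rewrite mulr0.
  rewrite mulrN Ez opprD -ropN//; apply: le_trans (_ : P (fun j => - z j) i <= _).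
    by rewrite gerDl oppr_le0.
  by apply: rop_le.
(* Bk k is B^k y for B = P / mu *)
pose Bk k i := mu ^- k * iter k P y i.
have Bk0 k i : 0 <= Bk k i.
  by rewrite mulr_ge0 ?invr_ge0 ?exprn_ge0 ?(ltW mu0) ?iter_rop_ge0.
have PBk k i : P (Bk k) i = mu * Bk k.+1 i.
  rewrite ropZ// /Bk iterS exprS; field.
  by rewrite expf_neq0 gt_eqF.
pose S N i := \sum_(0 <= k < N) Bk k i.
have PS N i : P (S N) i = mu * (S N i + Bk N i - y i).
  elim: N => [|N IH].
    rewrite /S big_geq// /Bk expr0 invr1 mul1r/= add0r subrr mulr0.
    have [r [_ _ Er]] := row_seq A_row i; rewrite Er big1// => j _.
    by rewrite big_geq// mulr0.
  have -> : P (S N.+1) i = P (fun j => S N j + Bk N j) i.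
    by apply: eq_rop => // j _; rewrite /S big_nat_recr.
  by rewrite ropD// IH PBk /S big_nat_recr//=; ring.
have ybound N i : y i <= Bk N i + 2 * e / mu * S N i.
  have iterS' k : iter k P (fun j => (l - e) * y j) i <= iter k.+1 P y i.
    by rewrite iterSr; apply: iter_rop_le.
  elim: N => [|N IH].
    by rewrite /S big_geq// /Bk expr0 invr1 mul1r/= mulr0 addr0.
  have step : Bk N i <= Bk N.+1 i + 2 * e / mu * Bk N i.
    have h := iterS' N; rewrite iter_ropZ// in h.
    have -> : Bk N.+1 i = mu^-1 * (mu ^- N * iter N.+1 P y i).
      by rewrite /Bk exprS; field; rewrite ?expf_neq0 gt_eqF.
    have {1}-> : Bk N i =
        mu^-1 * (mu ^- N * ((l - e) * iter N P y i)) + 2 * e / mu * Bk N i.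
      rewrite /Bk /mu; field; rewrite -/mu ?expf_neq0 gt_eqF//.
    rewrite lerD2r ler_wpM2l ?invr_ge0 ?(ltW mu0)// ler_wpM2l//.
    by rewrite invr_ge0 exprn_ge0// ltW.
  rewrite /S big_nat_recr//= mulrDr -/(S N i); move: IH step; lra.
have [n yn nmin] := normle_min yc'; have n0 := normle_ge0 yn.
pose q := mu1 / mu.
have hq : 0 <= q < 1 by rewrite divr_ge0 ?(ltW mu0)//= ltr_pdivrMr// mul1r.
have Bkn k : normle s (Bk k) (K1 * n * q ^+ k).
  have := normleZ hs (mu ^- k) (pb1 k _ _ yn).
  rewrite ger0_norm ?invr_ge0 ?exprn_ge0 ?(ltW mu0)//.
  by congr (normle s _ _); rewrite /q exprMn exprVn; ring.
have [cS ScS] : exists cS, forall N, normle s (S N) (cS N).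
  exists (fun N => \sum_(0 <= k < N) K1 * n * q ^+ k) => N.
  exact: (normle_sum hs).
have nle N : n <= 3 * (K1 * n * q ^+ N).
  have [v vS vmin] := normle_min (ScS N); have v0 := normle_ge0 vS.
  have cN0 := normle_ge0 (Bkn N); set cN := K1 * n * q ^+ N in cN0 *.
  have h1 : normle s (fun i => l * S N i - P (S N) i) (mu * (n + cN) + e * v).
    have := normleD hs (normleZ hs mu (normleD hs yn (Bkn N))) (normleZ hs e vS).
    rewrite -/cN (ger0_norm (ltW mu0)) (ger0_norm (ltW e0)).
    apply: (normle_mono hs) => i; rewrite PS.
    have := normr_ge0 (S N i); have := Bk0 N i; have := y0 i; move=> y0' B0' S0'.
    have S0 : 0 <= S N i by apply: sumr_ge0 => k _.
    rewrite [leRHS]ger0_norm; last by have := mulr_ge0 (ltW mu0) (addr_ge0 y0' B0'); have := mulr_ge0 (ltW e0) S0; lra.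
    have -> : l * S N i - mu * (S N i + Bk N i - y i)
       = mu * y i - (mu * Bk N i + e * S N i) by rewrite /mu; ring.
    apply: le_trans (ler_normB _ _) _.
    have m1 := mulr_ge0 (ltW mu0) y0'; have m2 := mulr_ge0 (ltW mu0) B0'.
    have m3 := mulr_ge0 (ltW e0) S0.
    by rewrite (ger0_norm m1) (ger0_norm (addr_ge0 m2 m3)); lra.
  have hv : v <= K0 * (mu * (n + cN) + e * v) by apply: vmin; apply: resol h1.
  have hn : n <= cN + 2 * e / mu * v.
    apply: nmin; have := normleD hs (Bkn N) (normleZ hs (2 * e / mu) vS).
    have th0 : 0 <= 2 * e / mu by rewrite divr_ge0 ?mulr_ge0 ?ltW.
    rewrite (ger0_norm th0); apply: (normle_mono hs) => i.
    rewrite ger0_norm//; apply: le_trans (ybound N i) _; exact: ler_norm.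
  have hv2 : v <= 2 * K0 * (mu * (n + cN)).
    have : K0 * e * v <= 1 / 8 * v by rewrite ler_wpM2r//; lra.
    have : K0 * (mu * (n + cN) + e * v) = K0 * (mu * (n + cN)) + K0 * e * v by ring.
    lra.
  have hv3 : 2 * e / mu * v <= 4 * (e * K0) * (n + cN).
    have th0 : 0 <= 2 * e / mu by rewrite divr_ge0 ?mulr_ge0 ?ltW.
    apply: le_trans (ler_wpM2l th0 hv2) _; rewrite le_eqVlt; apply/orP; left; apply/eqP.
    by field; rewrite gt_eqF.
  have : 4 * (e * K0) * (n + cN) <= 1 / 2 * (n + cN) by rewrite ler_wpM2r ?addr_ge0//; lra.
  lra.
have n00 : n <= 0.
  by apply: (@le_geometric0 _ q (3 * (K1 * n))) => // N; rewrite -mulrA.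
have yz : normle s y 0 by apply: normle_weak yn.
move=> i; have := congr1 (@^~ i) (normle_eq0 hs yz); rewrite /= => yi.
by have := zy i; rewrite yi oppr_le0.
Qed.

(** A nonnegative [z] with [lam z = P z + f] and [f >= 0] satisfies [lam z
    >= P z] and [lam z >= f], hence [lam^(k+1) z >= P^k f] by iteration: a
    nonnegative resolvent bounds all powers. *)
Lemma power_bounded_resolvent lam K : 0 < lam -> 0 <= K ->
  (forall f c, normle s f c -> (forall i, 0 <= f i) ->
     exists2 z, normle s z (K * c) &
       (forall i, 0 <= z i) /\ forall i, lam * z i = P z i + f i) ->
  power_bounded s A (K * lam) lam.
Proof.
move=> lam0 K0 h; split; rewrite ?mulr_ge0 ?(ltW lam0)// => k f c fc.
have fc' : normle s (fun i => `|f i|) c by apply: (normle_mono hs) fc => i; rewrite normr_id.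
have [z zc [z0 Ez]] := h _ _ fc' (fun i => normr_ge0 _).
have Pz i : P z i <= lam * z i by rewrite Ez lerDl.
have fz i : `|f i| <= lam * z i by rewrite Ez lerDr rop_ge0.
have Pkz j i : iter j P (fun i => lam * z i) i <= lam ^+ j.+1 * z i.
  elim: j i => [|j IH] i; first by rewrite expr1.
  rewrite iterS; apply: le_trans (rop_le A_ge0 A_row (fun j _ => IH j)) _.
  by rewrite ropZ// [X in _ <= X * _]exprSr -mulrA ler_wpM2l// exprn_ge0// ltW.
have := normleZ hs (lam ^+ k.+1) zc.
rewrite ger0_norm ?exprn_ge0 ?(ltW lam0)//.
have -> : lam ^+ k.+1 * (K * c) = K * lam * lam ^+ k * c by rewrite exprS; ring.
apply: (normle_mono hs) => i.
rewrite [leRHS]ger0_norm; last by rewrite mulr_ge0// exprn_ge0// ltW.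
apply: le_trans (Pkz k i); apply: (@le_trans _ _ (iter k P (fun i => `|f i|) i)).
  have up := iter_rop_le A_ge0 A_row k (fun i => ler_norm (f i)) i.
  have := iter_rop_le A_ge0 A_row k (fun i => lerNnormlW (lexx `|f i|)) i.
  have -> : (fun i => - `|f i|) = (fun i => -1 * `|f i|) by apply/funext => j; rewrite mulN1r.
  by rewrite iter_ropZ// mulN1r => low; rewrite ler_norml low up.
exact: iter_rop_le.
Qed.

(** The upper half of Gelfand's formula, obtained from positivity instead of
    complex analysis. Let [l] be the infimum of the growth rates of the
    powers. If [l > rho], the resolvent exists at [l] and slightly below it,
    where it is still nonnegative by [resolvent_positive]; then
    [power_bounded_resolvent] makes a number below [l] a growth rate. *)
Lemma spectral_radius_power_bounded lam : rho < lam -> exists K, power_bounded s A K lam.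
Proof.
move=> rl; apply: contrapT => npb.
pose S := [set x | exists K, power_bounded s A K x].
have S_ge x : S x -> lam <= x.
  move=> [K pb]; rewrite leNgt; apply/negP => xl; apply: npb; exists K.
  exact: power_bounded_le (ltW xl) pb.
have hS : has_inf S.
  split; last by exists lam => x /S_ge.
  by have [b _ pb] := power_bounded_norm; exists b, 1.
have rho0 := spectral_radius_ge0.
pose l := inf S; have laml : lam <= l by apply: lb_le_inf => [|x /S_ge//]; case: hS.
have rl' : rho < l by apply: lt_le_trans laml.
have [K0 K00 [_ resol]] := resolvent_real rl'.
(* l - e stays above rho, and 4 e K0 <= 1/2 is what resolvent_positive absorbs *)
pose e := Num.min ((l - rho) / 2) (8 * K0)^-1.
have e0 : 0 < e by rewrite lt_min invr_gt0; apply/andP; split; lra.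
have e1 : e <= (l - rho) / 2 by rewrite ge_min lexx.
have e2 : 8 * e * K0 <= 1.
  rewrite mulrAC -ler_pdivlMl ?mulr1; last lra.
  by rewrite ge_min lexx orbT.
have [mu1 [K1 pb1] mu1l] := inf_adherent e0 hS.
have re : rho < l - e by lra.
have [K' K'0 [exz _]] := resolvent_real re.
have Sle : S (l - e).
  exists (K' * (l - e)); apply: power_bounded_resolvent => [||f c fc f0]; [lra|exact: ltW|].
  have [z zc Ez] := exz _ _ fc; exists z => //; split=> //.
  apply: (resolvent_positive K00 e0 _ e2 mu1l pb1 resol zc f0 Ez); lra.
have := inf_lbound (proj2 hS) Sle; rewrite -/l; lra.
Qed.

End SpectralRadius.

(** * Equations on subsets of the index set *)

Section Compression.
Context {R : realType} {T : choiceType}.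
Variable A : T -> T -> R[i].

(** The equation [(I - tau A_F) x = e] for the principal submatrix on [F],
    with [x] extended by 0. Tails, finite sections and the whole matrix thus
    become problems on one index set that can be compared pointwise. *)
Definition solves (F : T -> bool) (tau : R[i]) (e x : T -> R[i]) : Prop :=
  (forall i, ~~ F i -> x i = 0) /\
  (forall i, F i -> x i = e i + tau * mxop A x i).

Context {s : \bar R}.
Hypothesis hs : (1 <= s)%E.
Hypothesis A_ge0 : forall i j, 0 <= A i j.
Hypothesis A_row : forall i, finite_set [set j | A i j != 0].
Local Notation P := (rop A).
Variables (K lam : R).
Hypothesis pb : power_bounded s A K lam.


Lemma normc_solves F tau e x i : solves F tau e x -> F i ->
  normc (x i) <= normc (e i) + normc tau * P (fun j => normc (x j)) i.
Proof.
move=> [_ xE] Fi; rewrite {1}xE//; apply: le_trans (le_normcD _ _) _.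
by rewrite lerD2l normcM ler_wpM2l ?normc_ge0 ?normc_mxop.
Qed.

(** Comparison with a supersolution for the moduli of [tau] and [e]. *)
Lemma solves_majorant F tau e x Y c c' : normc tau * lam < 1 -> solves F tau e x ->
  normle s (fun i => normc (x i)) c -> normle s Y c' ->
  (forall i, ~~ F i -> 0 <= Y i) ->
  (forall i, F i -> normc (e i) + normc tau * P Y i <= Y i) ->
  forall i, normc (x i) <= Y i.
Proof.
move=> q1 xs xc Yc Y0 hY i; rewrite -subr_le0.
have YcN : normle s (fun i => - Y i) c' by apply: (normle_mono hs) Yc => j; rewrite normrN.
apply: (maximum_principle hs A_ge0 A_row pb (normc_ge0 tau) q1 (normleD hs xc YcN)) => {}i.
have [Fi|nFi] := boolP (F i); last first.
  by left; rewrite (proj1 xs)// normc0 add0r oppr_le0 Y0.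
right; rewrite ropB// mulrBr.
have := hY i Fi; have := normc_solves xs Fi; lra.
Qed.

Lemma solves0_unique F tau x c : normc tau * lam < 1 -> solves F tau (fun=> 0) x ->
  normle s (fun i => normc (x i)) c -> x = fun=> 0.
Proof.
move=> q1 xs xc; apply/funext => i; apply/eq0_normc/eqP.
rewrite eq_le normc_ge0 andbT; move: i.
apply: (solves_majorant q1 xs xc (normle0 hs _)) => // i Fi.
by rewrite normc0 add0r rop_eq0// mulr0.
Qed.

Lemma nonneg_solution t f c : 0 <= t -> t * lam < 1 -> normle s f c -> (forall i, 0 <= f i) ->
  exists Y c', [/\ normle s Y c', forall i, 0 <= Y i & forall i, Y i = f i + t * P Y i].
Proof.
move=> t0 q1 fc f0; have nt : normc (t%:C : R[i]) = t by rewrite normc_real ger0_norm.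
have fc' : normle s (fun i => normc ((f i)%:C : R[i])) c.
  by apply: (normle_mono hs) fc => i; rewrite normc_real normr_id.
have [|y yc yE] := neumann_solution hs A_ge0 A_row pb (_ : normc t%:C * lam < 1) fc'.
  by rewrite nt.
set Y := fun i => complex.Re (y i).
have [c' Yc] : exists c', normle s Y c'.
  eexists; apply: (normle_mono hs) yc => i.
  by rewrite [leRHS]ger0_norm ?normc_ge0 ?Re_le_normc.
have YE i : Y i = f i + t * P Y i by rewrite /Y {1}yE ReD ReZ Re_mxop.
exists Y, c'; split=> // i; rewrite -oppr_le0; move: i.
have YcN : normle s (fun i => - Y i) c' by apply: (normle_mono hs) Yc => j; rewrite normrN.
apply: (maximum_principle hs A_ge0 A_row pb t0 q1 YcN) => i; right.
by rewrite ropN// mulrN lerN2 [leRHS]YE lerDr.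
Qed.

(** The real and imaginary parts solve real equations. The maximum
    principle, applied to the imaginary parts and to minus the real parts,
    gives nonnegativity; the difference of the real parts solves the
    homogeneous equation on [F], and is nonpositive off [F] because [x'] is
    nonnegative there. *)
Lemma solves_le (F F' : T -> bool) (t : R) (f : T -> R) x x' c c' : 0 <= t -> t * lam < 1 ->
  (forall i, F i -> F' i) -> (forall i, 0 <= f i) ->
  solves F t%:C (fun i => (f i)%:C) x -> solves F' t%:C (fun i => (f i)%:C) x' ->
  normle s (fun i => normc (x i)) c -> normle s (fun i => normc (x' i)) c' ->
  forall i, 0 <= x i /\ x i <= x' i.
Proof.
move=> t0 q1 FF f0 xs xs' xc xc'.
have MP := maximum_principle hs A_ge0 A_row pb t0 q1.
have ReIm G z d : solves G t%:C (fun i => (f i)%:C) z -> normle s (fun i => normc (z i)) d ->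
  [/\ normle s (fun i => complex.Re (z i)) d, forall i, complex.Im (z i) = 0,
     forall i, 0 <= complex.Re (z i), forall i, ~~ G i -> complex.Re (z i) = 0 &
     forall i, G i -> complex.Re (z i) = f i + t * P (fun j => complex.Re (z j)) i].
  move=> [z0 zE] zd.
  have Red : normle s (fun i => complex.Re (z i)) d.
    by apply: (normle_mono hs) zd => i; rewrite [leRHS]ger0_norm ?normc_ge0 ?Re_le_normc.
  have Imd : normle s (fun i => complex.Im (z i)) d.
    by apply: (normle_mono hs) zd => i; rewrite [leRHS]ger0_norm ?normc_ge0 ?Im_le_normc.
  have Re0 i : ~~ G i -> complex.Re (z i) = 0 by move=> /z0 ->.
  have Im0 i : ~~ G i -> complex.Im (z i) = 0 by move=> /z0 ->.
  have ReE i : G i -> complex.Re (z i) = f i + t * P (fun j => complex.Re (z j)) i.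
    by move=> /zE ->; rewrite ReD ReZ Re_mxop.
  have ImE i : G i -> complex.Im (z i) = t * P (fun j => complex.Im (z j)) i.
    by move=> /zE ->; rewrite ImD ImZ Im_mxop// add0r.
  have Nd (g : T -> R) : normle s g d -> normle s (fun i => - g i) d.
    by apply: (normle_mono hs) => j; rewrite normrN.
  split=> // i.
    apply/eqP; rewrite eq_le; apply/andP; split; move: i.
      apply: (MP _ _ Imd) => i; have [Gi|nGi] := boolP (G i); last by left; rewrite Im0.
      by right; rewrite {1}ImE.
    move=> i; rewrite -oppr_le0; move: i; apply: (MP _ _ (Nd _ Imd)) => i.
    have [Gi|nGi] := boolP (G i); last by left; rewrite Im0 ?oppr0.
    by right; rewrite ropN// {1}ImE// mulrN.
  rewrite -oppr_le0; move: i; apply: (MP _ _ (Nd _ Red)) => i.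
  have [Gi|nGi] := boolP (G i); last by left; rewrite Re0 ?oppr0.
  by right; rewrite ropN// {1}ReE// mulrN opprD gerDr oppr_le0.
have [Rc I0 R0 Rn RE] := ReIm F x c xs xc.
have [Rc' I0' R0' Rn' RE'] := ReIm F' x' c' xs' xc'.
have le i : complex.Re (x i) <= complex.Re (x' i).
  rewrite -subr_le0; move: i.
  have Nd : normle s (fun i => - complex.Re (x' i)) c'.
    by apply: (normle_mono hs) Rc' => j; rewrite normrN.
  apply: (MP _ _ (normleD hs Rc Nd)) => i; have [Fi|nFi] := boolP (F i).
    by right; rewrite ropB// {1}RE// {1}RE' ?FF// mulrBr opprD addrACA subrr add0r.
  by left; rewrite Rn// add0r oppr_le0.
move=> i; have := R0 i; have := le i; have := I0 i; have := I0' i.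
by case: (x i) => a b; case: (x' i) => a' b'; rewrite !lecE/= => -> -> -> ->; rewrite !eqxx.
Qed.

Variable blk : T -> nat.
Hypothesis A_tridiag : forall i j, A i j != 0 ->
  (blk j <= (blk i).+1)%N /\ (blk i <= (blk j).+1)%N.

(** A closed walk from block [m] that leaves the blocks [m, .., N] has at
    least [2 a] steps, where [a = N - m + 1]. To turn this into an estimate,
    let [Y] solve the equation on the whole index set for the moduli of
    [tau] and [e], and let [W k] be the tail from [k] on of its Neumann
    series. Outside the blocks [m, .., N] one has [|y - x| <= Y = W a],
    because the first [a] terms of the series vanish beyond block [N]; by
    the maximum principle [|y - x| <= W a] everywhere. Inside, [|y - x|] is
    at most [|tau| P] applied to itself, so every block walked back from [N
    + 1] towards [m] raises the index of [W] by one, and [W (2 a)] remains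
    on block [m]. Comparing with the scalar tail directly, rather than
    composing two estimates, keeps the constant [K] to the first power. *)
Lemma truncation_error m N tau e c x y cx cy : (m <= N)%N -> normc tau * lam < 1 ->
  (forall i, blk i != m -> e i = 0) -> normle s (fun i => normc (e i)) c ->
  solves (fun i => m <= blk i <= N)%N tau e x -> normle s (fun i => normc (x i)) cx ->
  solves (fun i => m <= blk i)%N tau e y -> normle s (fun i => normc (y i)) cy ->
  normle s (fun i => if (blk i <= m)%N then normc (y i - x i) else 0)
    (K * ((normc tau * lam) ^+ (2 * (N - m + 1)) / (1 - normc tau * lam)) * c).
Proof.
move=> mN q1 e0 ec xs xc ys yc; set t := normc tau; set q := t * lam.
have [K0 lam0 pbk] := pb.
have t0 : 0 <= t by exact: normc_ge0.
have q0 : 0 <= q by rewrite mulr_ge0.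
have hq : 0 <= q < 1 by rewrite q0.
have c0 := normle_ge0 ec.
pose E i := normc (e i); have E0 i : 0 <= E i by exact: normc_ge0.
have [Y [cY [Yc Y0 YE]]] := nonneg_solution t0 q1 ec E0.
have cY0 := normle_ge0 Yc.
pose W k i := t ^+ k * iter k P Y i.
pose D k i := t ^+ k * iter k P E i.
have W0 k i : 0 <= W k i by rewrite mulr_ge0 ?exprn_ge0 ?iter_rop_ge0.
have D0 k i : 0 <= D k i by rewrite mulr_ge0 ?exprn_ge0 ?iter_rop_ge0.
have WS k i : t * P (W k) i = W k.+1 i by rewrite ropZ// mulrA -exprS.
have WD k i : W k i = D k i + W k.+1 i.
  rewrite /W /D {1}(_ : Y = fun j => E j + t * P Y j); last by apply/funext => j.
  by rewrite iter_ropD// iter_ropZ// mulrDr -iterSr mulrA -exprSr.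
have D_supp k i : (m + k < blk i)%N -> D k i = 0.
  rewrite /D => h; suff -> : iter k P E i = 0 by rewrite mulr0.
  elim: k i h => [|k IH] i h.
    by rewrite /E /= e0 ?normc0// gtn_eqF//; move: h; rewrite addn0.
  rewrite iterS rop_eq0// => j Aij; apply: IH.
  by have [_ ij] := A_tridiag Aij; clear -h ij; lia.
(* beyond the support of the first k terms, Y is its own tail *)
have YW k i : (m + k <= blk i)%N -> Y i = W k i.
  elim: k => [|k IH] h; first by rewrite /W expr0 mul1r.
  by rewrite IH ?(WD k i) ?D_supp ?add0r//; clear -h; lia.
have WD_sum k n i : (k <= n)%N -> W k i = \sum_(k <= j < n) D j i + W n i.
  move=> kn; rewrite -(subnKC kn); elim: (n - k)%N => [|j IH].
    by rewrite addn0 big_geq// add0r.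
  by rewrite addnS big_nat_recr ?leq_addr//= -addrA -WD.
pose d i := normc (y i - x i).
have d_le : forall i, (m <= blk i <= N)%N -> d i <= t * P d i.
  move=> i Fi; have /andP[mi iN] := Fi.
  rewrite /d (proj2 xs)// (proj2 ys)// addrAC opprD addrA subrr add0r addrC -mulrBr -mxopB//.
  by rewrite normcM ler_wpM2l// normc_mxop.
have d_small i : (blk i < m)%N -> d i = 0.
  by move=> im; rewrite /d (proj1 xs) ?(proj1 ys) ?subr0 ?normc0//= -?ltnNge// leqNgt im.
have y_le : forall i, normc (y i) <= Y i.
  apply: (solves_majorant q1 ys yc Yc) => // i Fi.
  by rewrite [leRHS]YE.
set a := (N - m + 1)%N.
have W_norm k n : (k <= n)%N ->
    normle s (W k) (K * (q ^+ k / (1 - q)) * c + K * cY * q ^+ n).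
  move=> kn; pose bound j := K * q ^+ j * c.
  have Dn j : normle s (D j) (bound j).
    have := normleZ hs (t ^+ j) (pbk j _ _ ec); rewrite ger0_norm ?exprn_ge0//.
    by congr (normle s _ _); rewrite /bound /q exprMn; ring.
  have Wn : normle s (W n) (K * cY * q ^+ n).
    have := normleZ hs (t ^+ n) (pbk n _ _ Yc); rewrite ger0_norm ?exprn_ge0//.
    by congr (normle s _ _); rewrite /q exprMn; ring.
  have h := normleD hs (normle_sum hs (index_iota k n) Dn) Wn.
  have {}h : normle s (W k) (\sum_(k <= j < n) bound j + K * cY * q ^+ n).
    by apply: (normle_mono hs) h => i; rewrite (WD_sum k n).
  apply: normle_weak h; rewrite lerD2r -mulr_suml -mulr_sumr ler_wpM2r// ler_wpM2l//.
  exact: geometric_tail.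
have d_le_W : forall i, d i <= W a i.
  move=> i; rewrite -subr_le0; move: i.
  have dc : normle s d (cy + cx).
    apply: (normle_mono hs) (normleD hs yc xc) => i.
    rewrite !ger0_norm ?addr_ge0 ?normc_ge0//.
    by apply: le_trans (le_normcD _ _) _; rewrite normcN.
  have Wc := W_norm a a (leqnn a).
  have {}Wc : normle s (fun i => - W a i) (K * (q ^+ a / (1 - q)) * c + K * cY * q ^+ a).
    by apply: (normle_mono hs) Wc => i; rewrite normrN.
  apply: (maximum_principle hs A_ge0 A_row pb t0 q1 (normleD hs dc Wc)) => i.
  have [im|im] := ltnP (blk i) m.
    by left; rewrite d_small// add0r oppr_le0.
  have [iN|Ni] := leqP (blk i) N; last first.
    left; rewrite subr_le0 /d (proj1 xs) ?subr0; last by rewrite negb_and -(ltnNge N) Ni orbT.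
    by rewrite -YW ?y_le// /a; clear -mN Ni; lia.
  right; rewrite ropB// mulrBr (WS a i).
  have := d_le i; rewrite im iN => /(_ isT).
  by have := WD a i; have := D0 a i; lra.
have d_le_W2 j i : (blk i + j <= N + 1)%N -> d i <= W (a + j)%N i.
  elim: j i => [|j IH] i h; first by rewrite addn0.
  have [im|im] := ltnP (blk i) m; first by rewrite d_small.
  apply: le_trans (d_le i _) _; first by clear -im h; lia.
  rewrite addnS -WS ler_wpM2l//; apply: rop_le => // k Aik; apply: IH.
  by have [ki _] := A_tridiag Aik; clear -h ki; lia.
set f := (X in normle s X _).
have f_le i : `|f i| <= `|W (2 * a)%N i|.
  rewrite (ger0_norm (W0 _ _)) /f; case: leqP => im; last by rewrite normr0.
  rewrite ger0_norm ?normc_ge0// mul2n -addnn; apply: d_le_W2.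
  by rewrite /a; clear -im mN; lia.
have fb n : normle s f (K * (q ^+ (2 * a) / (1 - q)) * c + K * cY * q ^+ (2 * a) * q ^+ n).
  have := W_norm (2 * a)%N (2 * a + n)%N (leq_addr _ _).
  by rewrite exprD [K * cY * (_ * _)]mulrA; apply: (normle_mono hs).
have [v fv vmin] := normle_min (fb 0%N).
apply: normle_weak fv; rewrite -subr_le0.
apply: (@le_geometric0 _ q (K * cY * q ^+ (2 * a))) => // n.
by rewrite lerBlDl vmin.
Qed.

End Compression.

(** * Compression to a smaller index set *)

Section Extension.
Context {I T : choiceType} (phi : I -> T) (phi_inj : injective phi).

Definition extend0 (V : nmodType) (v : I -> V) (u : T) : V :=
  if pselect (exists i, phi i = u) is left h then v (projT1 (cid h)) else 0.

Lemma ext_in (V : nmodType) (v : I -> V) i : extend0 v (phi i) = v i.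
Proof.
rewrite /extend0; case: pselect => [h|[]]; last by exists i.
by congr v; apply: phi_inj; case: (cid h).
Qed.

Lemma ext_out (V : nmodType) (v : I -> V) u : (forall i, phi i <> u) -> extend0 v u = 0.
Proof. by move=> h; rewrite /extend0; case: pselect => // h'; exfalso; case: h' => i /h. Qed.

Variant ext_spec (V : nmodType) (v : I -> V) u : V -> Prop :=
  | ExtIn i of u = phi i : ext_spec v u (v i)
  | ExtOut of (forall i, phi i <> u) : ext_spec v u 0.

Lemma extP (V : nmodType) (v : I -> V) u : ext_spec v u (extend0 v u).
Proof.
have [[i <-]|h] := pselect (exists i, phi i = u); first by rewrite ext_in; exact: ExtIn.
have h' i : phi i <> u by move=> e; apply: h; exists i.
by rewrite ext_out//; exact: ExtOut.
Qed.

Lemma fsum_ext (V : nmodType) (F : T -> V) : (forall u, (forall i, phi i <> u) -> F u = 0) ->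
  \sum_(u \in [set: T]) F u = \sum_(i \in [set: I]) F (phi i).
Proof.
move=> F0; rewrite -(fsbig_widen (phi @` [set: I]) [set: T])//; last first.
  by move=> u [_ h] /=; apply: F0 => i e; apply: h; exists i.
by rewrite fsbig_image// => i j _ _; exact: phi_inj.
Qed.

Context {R : realType} {s : \bar R}.
Hypothesis hs : (1 <= s)%E.

Lemma normle_ext (f : I -> R) c : normle s f c -> normle s (extend0 f) c.
Proof.
move=> fc; have [[u0 hu0]|no] := pselect (exists u, extend0 f u != 0); last first.
  have -> : extend0 f = fun=> 0.
    by apply/funext => u; apply/eqP/negPn/negP => h; apply: no; exists u.
  exact: normle_weak (normle_ge0 fc) (normle0 hs _).
have [i0 _] : exists i0 : I, True.
  by move: hu0; case: (extP f u0) => [i _ _|]; [exists i|rewrite eqxx].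
pose psi u := if pselect (exists i, phi i = u) is left h then projT1 (cid h) else i0.
have psiK i : psi (phi i) = i.
  rewrite /psi; case: pselect => [h|[]]; last by exists i.
  by apply: phi_inj; case: (cid h).
apply: (normle_inj hs (phi := psi)) fc => [u u'|u].
  case: (extP f u) => [i ->|]; last by rewrite eqxx.
  case: (extP f u') => [j ->|]; last by rewrite eqxx.
  by rewrite !psiK => _ _ ->.
case: (extP f u) => [i ->|]; last by rewrite normr0.
by rewrite psiK.
Qed.

Lemma normc_ext (v : I -> R[i]) : (fun u => normc (extend0 v u)) = extend0 (fun i => normc (v i)).
Proof.
apply/funext => u; case: (extP v u) => [i ->|h]; first by rewrite ext_in.
by rewrite ext_out ?normc0.
Qed.

Lemma normle_restrict (f : T -> R) c : normle s f c -> normle s (fun i => f (phi i)) c.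
Proof. by apply: (normle_inj hs (phi := phi)) => // i j _ _; exact: phi_inj. Qed.

Variable A : T -> T -> R[i].

Lemma mxop_ext (v : I -> R[i]) u :
  mxop A (extend0 v) u = \sum_(i \in [set: I]) A u (phi i) * v i.
Proof.
rewrite /mxop fsum_ext => [|u' h]; last by rewrite ext_out ?mulr0.
by apply: eq_fsbigr => i _; rewrite ext_in.
Qed.

Hypothesis A_ge0 : forall i j, 0 <= A i j.
Hypothesis A_row : forall i, finite_set [set j | A i j != 0].
Variable B : I -> I -> R[i].
Hypothesis B_comp : forall i j, B i j = A (phi i) (phi j).

Lemma mxop_compression v i : mxop B v i = mxop A (extend0 v) (phi i).
Proof. by rewrite mxop_ext; apply: eq_fsbigr => j _; rewrite B_comp. Qed.

Lemma compression_ge0 i j : 0 <= B i j.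
Proof. by rewrite B_comp. Qed.

Lemma compression_row i : finite_set [set j | B i j != 0].
Proof.
have -> : [set j | B i j != 0] = phi @^-1` [set u | A (phi i) u != 0].
  by apply/seteqP; split => j /=; rewrite B_comp.
by apply: finite_preimage => // j k _ _; exact: phi_inj.
Qed.

Lemma rop_compression_le f g i : (forall j, f j <= g (phi j)) -> (forall u, 0 <= g u) ->
  rop B f i <= rop A g (phi i).
Proof.
move=> fg g0; apply: (@le_trans _ _ (rop A (extend0 (fun j => g (phi j))) (phi i))).
  rewrite [leRHS]/rop fsum_ext => [|u h]; last by rewrite ext_out ?mulr0.
  rewrite [leRHS](_ : _ = rop B (fun j => g (phi j)) i); last first.
    by apply: eq_fsbigr => j _; rewrite ext_in B_comp.
  apply: rop_le => //; [exact: compression_ge0|exact: compression_row].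
apply: rop_le => // u _; case: (extP _ u) => [j ->|] //.
Qed.

(** Restricting a nonnegative matrix to fewer indices only discards
    nonnegative terms of row sums, so its powers cannot grow faster. *)
Lemma power_bounded_compression K lam : power_bounded s A K lam -> power_bounded s B K lam.
Proof.
move=> [K0 l0 pb]; split=> // k f c fc.
have fc' : normle s (extend0 (fun i => `|f i|)) c.
  by apply: normle_ext; apply: (normle_mono hs) fc => i; rewrite normr_id.
have e0 u : 0 <= extend0 (fun i => `|f i|) u by case: extP.
have it0 j u : 0 <= iter j (rop A) (extend0 (fun i => `|f i|)) u by exact: iter_rop_ge0.
have le j (g : I -> R) : (forall i, g i <= `|f i|) ->
    forall i, iter j (rop B) g i <= iter j (rop A) (extend0 (fun i => `|f i|)) (phi i).
  move=> gf; elim: j => [|j IH] i; first by rewrite /= ext_in.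
  by rewrite !iterS; apply: rop_compression_le.
apply: (normle_mono hs) (normle_restrict (pb k _ _ fc')) => i.
rewrite [leRHS]ger0_norm// ler_norml le ?andbT; last by move=> j; exact: ler_norm.
have := le k (fun j => -1 * f j) _ i; rewrite (iter_ropZ compression_row) mulN1r lerNl; apply.
by move=> j; rewrite mulN1r -normrN ler_norm.
Qed.

End Extension.

(** * Height blocks *)

Section HeightBlocks.
Context {p q : nat} (hp : (1 <= p)%N).
Local Notation w := (width p q).

Lemma width_gt0 : (0 < w)%N.
Proof.
rewrite /width leq_max /stepP divn_gt0 ?gcdn_gt0 ?hp//.
by rewrite dvdn_leq ?dvdn_gcdl.
Qed.

Lemma base_subproof m (x : hindex p q m) :
  is_index p q (val x) && (0 * w <= (val x).1)%N.
Proof. by have /andP[->] := valP x. Qed.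

(** All tails are placed in the whole index set, where they are told apart
    by the number [blk] of the height block. *)
Definition base m (x : hindex p q m) : hindex p q 0 := Sub (val x) (base_subproof x).

Lemma base_inj m : injective (@base m).
Proof. by move=> x y /(congr1 val) e; exact: val_inj. Qed.

Definition blk (x : hindex p q 0) : nat := ((val x).1 %/ w)%N.

Lemma blk_base m (x : hindex p q m) : (m <= blk (base x))%N.
Proof. by rewrite /blk leq_divRL ?width_gt0//; have /andP[] := valP x. Qed.

Lemma base_surj m u : (m <= blk u)%N -> exists x : hindex p q m, base x = u.
Proof.
rewrite /blk leq_divRL ?width_gt0// => h.
have hx : is_index p q (val u) && (m * w <= (val u).1)%N.
  by rewrite h andbT; have /andP[] := valP u.
by exists (Sub (val u) hx); apply: val_inj.
Qed.

Lemma block_uniq m : uniq (block p q m).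
Proof.
rewrite /block pmap_sub_uniq// allpairs_uniq ?iota_uniq//.
by move=> [a b] [c d].
Qed.

Lemma mem_block m (x : hindex p q m) : (x \in block p q m) = (blk (base x) == m).
Proof.
have /andP[hx hm] := valP x.
rewrite /block mem_pmap_sub/= eqn_leq blk_base andbT /blk/=.
rewrite -ltnS ltn_divLR ?width_gt0//.
apply/idP/idP => [/allpairsP[[a b] /= [+ _ e]]|h]; last apply/allpairsP.
  by rewrite mem_iota -mulSnr => /andP[_]; rewrite e.
exists (val x); split; last exact: surjective_pairing.
  by rewrite mem_iota hm/= -mulSnr.
by rewrite mem_iota addnC addn1; have /and3P[] := hx.
Qed.

Definition block_pos m (i : 'I_(bsize p q m)) : hindex p q 0 := base (bindex i).

Lemma bindex_inj m : injective (@bindex p q m).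
Proof. by apply/tuple_uniqP; exact: block_uniq. Qed.

Lemma block_pos_inj m : injective (@block_pos m).
Proof. by move=> i j /base_inj /bindex_inj. Qed.

Lemma blk_block_pos m (i : 'I_(bsize p q m)) : blk (block_pos i) = m.
Proof. by apply/eqP; rewrite -mem_block; exact: mem_tnth. Qed.

Lemma block_pos_surj m u : blk u = m -> exists i : 'I_(bsize p q m), block_pos i = u.
Proof.
move=> bu; have [x xu] : exists x : hindex p q m, base x = u by apply: base_surj; rewrite bu.
have : x \in in_tuple (block p q m) by rewrite mem_block xu bu.
by move=> /tnthP[i xi]; exists i; rewrite /block_pos /bindex -xi.
Qed.

Context {R : realType} (ell u : nat -> nat -> R[i]).

Lemma Hentry_neq0 x y : Hentry p q ell u x y != 0 ->
  y.2 = succj p q x.2 /\ (y.1 = x.1 + stepQ p q \/ y.1 + stepP p q = x.1)%N.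
Proof.
rewrite /Hentry; have [e2|_] := eqVneq y.2 (succj p q x.2); last by rewrite eqxx.
have [e1|_] := eqVneq y.1 (x.1 + stepQ p q)%N; first by split=> //; left.
have [e1|_] := eqVneq (y.1 + stepP p q)%N x.1; first by split=> //; right.
by rewrite eqxx.
Qed.

Lemma Htail_row m x : finite_set [set y | @Htail R p q ell u m x y != 0].
Proof.
pose r := [:: ((val x).1 + stepQ p q, succj p q (val x).2);
              ((val x).1 - stepP p q, succj p q (val x).2)]%N.
apply: (@sub_finite_set _ _ [set` (pmap insub r : seq (hindex p q m))]); last exact: finite_seq.
move=> y /= /Hentry_neq0 [e2 h].
have -> : (y \in (pmap insub r : seq (hindex p q m))) = (val y \in r) by rewrite mem_pmap_sub.
rewrite !inE [val y]surjective_pairing e2.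
by case: h => h; [rewrite h eqxx|rewrite -h addnK eqxx orbT].
Qed.

(** An entry moves the height by [Q] up or [P] down, at most the width of a
    block. *)
Lemma Htail_tridiag (x y : hindex p q 0) : Htail ell u x y != 0 ->
  (blk y <= (blk x).+1)%N /\ (blk x <= (blk y).+1)%N.
Proof.
have W := width_gt0.
have Pw : (stepP p q <= w)%N by rewrite leq_max leqnn.
have Qw : (stepQ p q <= w)%N by rewrite leq_max leqnn orbT.
have step a b : (a <= b + w)%N -> (a %/ w <= (b %/ w).+1)%N.
  by move=> /(leq_div2r w); rewrite divnDr// divnn W addn1.
move=> /Hentry_neq0 [_ h]; rewrite /blk; split; apply: step; case: h => h; lia.
Qed.

Lemma Htail_base m (x y : hindex p q m) : Htail ell u x y = Htail ell u (base x) (base y).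
Proof. by []. Qed.

Lemma HblockE k l i j : Hblock p q ell u k l i j = Htail ell u (block_pos i) (block_pos j).
Proof. by rewrite mxE. Qed.

Definition section_pos m n (t : 'I_(\sum_(i < n.+1) bsize p q (i + m))) : hindex p q 0 :=
  block_pos (tagnat.sig2 t).

Lemma section_pos_Rank m n (i : 'I_n.+1) (j : 'I_(bsize p q (i + m))) :
  @section_pos m n (tagnat.Rank i j) = block_pos j.
Proof.
pose g (x : {i : 'I_n.+1 & 'I_(bsize p q (i + m))}) := block_pos (tagged x).
by rewrite -[LHS]/(g (tagnat.sig _)) tagnat.rankK.
Qed.

Lemma section_pos_inj m n : injective (@section_pos m n).
Proof.
move=> t t'; rewrite -(tagnat.sig2K t) -(tagnat.sig2K t') !section_pos_Rank.
move: (tagnat.sig1 t) (tagnat.sig2 t) (tagnat.sig1 t') (tagnat.sig2 t').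
move=> i j i' j' e; have := congr1 blk e; rewrite !blk_block_pos => /addIn/val_inj ii'.
by case: _ / ii' in j' e *; rewrite (block_pos_inj e).
Qed.

Lemma blk_section_pos m n (t : 'I_(\sum_(i < n.+1) bsize p q (i + m))) :
  (m <= blk (section_pos t) <= n + m)%N.
Proof.
by rewrite /section_pos blk_block_pos leq_addl leq_add2r -ltnS ltn_ord.
Qed.

Lemma section_pos_surj m n v : (m <= blk v <= n + m)%N -> exists t, @section_pos m n t = v.
Proof.
move=> /andP[mv vn]; have hk : (blk v - m < n.+1)%N by lia.
have [j jv] : exists j : 'I_(bsize p q (Ordinal hk + m)), block_pos j = v.
  by apply: block_pos_surj; rewrite /= subnK.
by exists (tagnat.Rank (Ordinal hk) j); rewrite section_pos_Rank.
Qed.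

Lemma HsectionE m n t t' :
  Hsection p q ell u m n t t' = Htail ell u (section_pos t) (section_pos t').
Proof. by rewrite mxE HblockE. Qed.

End HeightBlocks.

(** * Convergents as traces of solutions *)

Lemma unitmx_inj (F : fieldType) n (M : 'M[F]_n) :
  (forall v : 'cV[F]_n, M *m v = 0 -> v = 0) -> M \in unitmx.
Proof.
move=> inj; rewrite -unitmx_tr unitmxE unitfE; apply/negP => /det0P[v v0 vM].
move/eqP: v0; apply; apply: trmx_inj; rewrite trmx0; apply: inj.
by rewrite -[M]trmxK -trmx_mul vM trmx0.
Qed.

Lemma ext_sum (I : finType) (T : choiceType) (phi : I -> T) (F : pzRingType)
  (v : I -> F) u : injective phi -> extend0 phi v u = \sum_j (u == phi j)%:R * v j.
Proof.
move=> inj; case: (extP inj v u) => [i ->|h].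
  rewrite (bigD1 i)//= eqxx mul1r big1 ?addr0// => j ji.
  by rewrite inj_eq// eq_sym (negbTE ji) mul0r.
by rewrite big1// => j _; case: eqP => [e|_]; [case: (h j)|rewrite mul0r].
Qed.

Lemma normle_fin (R : realType) (s : \bar R) (I : finType) (f : I -> R) : (1 <= s)%E ->
  exists c, normle s f c.
Proof.
move=> hs; eexists.
have := normle_sum hs (index_enum I) (fun k => normleZ hs (f k) (normle_delta hs k)).
apply: (normle_mono hs) => i; rewrite (bigD1 i)//= eqxx mulr1 big1 ?addr0// => j ji.
by rewrite eq_sym (negbTE ji) mulr0.
Qed.

Lemma mxop_ext_fin (R : realType) (I : finType) (T : choiceType) (phi : I -> T)
  (A : T -> T -> R[i]) (v : I -> R[i]) u : injective phi ->
  mxop A (extend0 phi v) u = \sum_j A u (phi j) * v j.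
Proof.
move=> inj; rewrite mxop_ext//.
rewrite (fsbig_fwiden (index_enum I))//; last by move=> j [_ []].
  by move=> j _ /=; rewrite mem_index_enum.
exact: index_enum_uniq.
Qed.

Section Main.
Context {R : realType} {p q : nat} (hp : (1 <= p)%N).
Context {ell u : nat -> nat -> R[i]} {s : \bar R} (hs : (1 <= s)%E).
Local Notation A := (@Htail R p q ell u 0).
Hypothesis A_ge0 : forall x y : hindex p q 0, 0 <= A x y.
Variables (K lam : R).
Hypothesis pb : power_bounded s A K lam.

Let A_row := @Htail_row p q R ell u 0.
Let A_tri := Htail_tridiag hp (q := q) (ell := ell) (u := u).

Lemma tail_inverse m tau : normc tau * lam < 1 ->
  exists G, inverse_op s (fun x => x - tau *: mxop (@Htail R p q ell u m) x) G.
Proof.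
move=> q1.
have comp i j := @Htail_base p q R ell u m i j.
apply: (neumann_inverse hs _ _ _ q1).
- exact: (compression_ge0 A_ge0 comp).
- exact: Htail_row.
- exact: (power_bounded_compression (@base_inj p q m) hs A_ge0 A_row comp pb).
Qed.

Lemma normle_ext_fin (I : finType) (T : choiceType) (phi : I -> T) (v : I -> R[i]) :
  injective phi -> exists c, normle s (fun x => normc (extend0 phi v x)) c.
Proof.
move=> inj; have [c vc] := normle_fin (fun i => normc (v i)) hs.
by exists c; rewrite normc_ext//; apply: normle_ext.
Qed.

(** The columns of [Phi] are values of the resolvent at unit vectors; by
    linearity [Phi v] is the trace on block [m] of the solution with source
    [v]. With [Phi_fin_solves], this reduces every claim on the convergents
    to a comparison of solutions. *)
Lemma Phi_solves m tau (v : 'I_(bsize p q m) -> R[i]) : normc tau * lam < 1 ->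
  exists y, [/\ solves A (fun x => m <= blk x)%N tau (extend0 (@block_pos p q m) v) y,
    exists c, normle s (fun x => normc (y x)) c &
    forall i, y (block_pos i) = \sum_j Phi p q ell u s m tau i j * v j].
Proof.
move=> q1; have [G0 hG0] := tail_inverse m q1.
have [[Glin Goo] GK] : inverse_op s (fun x => x - tau *: mxop (@Htail R p q ell u m) x)
    (resolvent s (@Htail R p q ell u m) tau) by apply: (xgetPex _ (ex_intro _ G0 hG0)).
set G := resolvent _ _ _ in Glin Goo GK.
pose d j : hindex p q m -> R[i] := fun y => (y == bindex j)%:R.
have ld j : lspace s (d j).
  apply/lspaceP; exists 1; apply: (normle_mono hs) (normle_delta hs (bindex j)) => x.
  by rewrite /d; case: eqP => _; rewrite ?normc1 ?normc0.
have [b b0 Gb] := bounded_op_bound hs (conj Glin Goo).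
have inj := @base_inj p q m; have binj := @block_pos_inj p q m.
pose z x := \sum_j G (d j) x * v j.
have row := @Htail_row p q R ell u m.
exists (extend0 (@base p q m) z); split.
- split=> [x|x] hx.
    by rewrite ext_out// => x' e; move: hx; rewrite -e blk_base.
  have [x' <-] := base_surj hp hx.
  rewrite ext_in// -(mxop_compression inj (B := @Htail R p q ell u m))//.
  rewrite ext_sum// /z mxop_sum// mulr_sumr -big_split; apply: eq_bigr => j _.
  have -> : mxop (@Htail R p q ell u m) (fun x => G (d j) x * v j) x'
     = v j * mxop (@Htail R p q ell u m) (G (d j)) x'.
    rewrite -(mxopZ row (v j) (G (d j)) x').
    by congr (mxop _ _ x'); apply/funext => y; rewrite mulrC.
  have [_ /(congr1 (@^~ x'))] := GK _ (ld j).
  rewrite -[X in X = _]/(G (d j) x' - tau * mxop (@Htail R p q ell u m) (G (d j)) x').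
  move=> /(canRL (subrK _)) ->.
  by rewrite /d -(inj_eq inj) /=; ring.
- have zn j : normle s (fun x => normc (v j) * normc (G (d j) x)) (`|normc (v j)| * (b * 1)).
    apply: normleZ => //; apply: Gb.
    by apply: (normle_mono hs) (normle_delta hs (bindex j)) => x; rewrite /d;
      case: eqP => _; rewrite ?normc1 ?normc0.
  eexists; rewrite normc_ext//; apply: (normle_ext inj hs).
  apply: (normle_mono hs) (normle_sum hs (index_enum _) zn) => x.
  rewrite ger0_norm ?normc_ge0// ger0_norm; last first.
    by apply: sumr_ge0 => j _; rewrite mulr_ge0 ?normc_ge0.
  apply: le_trans (normc_sum _ _) _; apply: ler_sum => j _.
  by rewrite normcM mulrC.
- by move=> i; rewrite ext_in//; apply: eq_bigr => j _; rewrite mxE.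
Qed.

Lemma section_solves m n tau (V : 'cV[R[i]]_(\sum_(i < n.+1) bsize p q (i + m))) e :
  (forall t, e (section_pos t) = ((1%:M - tau *: Hsection p q ell u m n) *m V) t ord0) ->
  solves A (fun x => m <= blk x <= n + m)%N tau e (extend0 (@section_pos p q m n) (fun t => V t ord0)).
Proof.
move=> hV; have inj := section_pos_inj (p := p) (q := q) hp (m := m) (n := n).
split=> x hx.
  by rewrite ext_out// => t e'; move: hx; rewrite -e' blk_section_pos.
have [t <-] := section_pos_surj hp hx.
rewrite ext_in// hV mxop_ext_fin// mulmxBl mul1mx -scalemxAl !mxE.
have -> : \sum_j Hsection p q ell u m n t j * V j ord0
    = \sum_j A (section_pos t) (section_pos j) * V j ord0.
  by apply: eq_bigr => j _; rewrite HsectionE.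
by rewrite subrK.
Qed.

Lemma section_unit m n tau : normc tau * lam < 1 ->
  1%:M - tau *: Hsection p q ell u m n \in unitmx.
Proof.
move=> q1; apply: unitmx_inj => V MV.
have inj := section_pos_inj (p := p) (q := q) hp (m := m) (n := n).
have sol : solves A (fun x => m <= blk x <= n + m)%N tau (fun=> 0)
    (extend0 (@section_pos p q m n) (fun t => V t ord0)).
  by apply: section_solves => t; rewrite MV mxE.
have [c xc] := normle_ext_fin (fun t => V t ord0) inj.
have x0 := solves0_unique hs A_ge0 A_row pb q1 sol xc.
apply/matrixP => t j; rewrite ord1 mxE.
by have := congr1 (@^~ (section_pos t)) x0; rewrite /= ext_in.
Qed.

Lemma Phi_fin_solves m N tau (v : 'I_(bsize p q m) -> R[i]) : (m <= N)%N ->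
  normc tau * lam < 1 ->
  exists x, [/\ solves A (fun x => m <= blk x <= N)%N tau (extend0 (@block_pos p q m) v) x,
    exists c, normle s (fun y => normc (x y)) c &
    forall i, x (block_pos i) = \sum_j Phi_fin p q ell u m N tau i j * v j].
Proof.
move=> mN q1; set n := (N - m)%N.
have inj := section_pos_inj (p := p) (q := q) hp (m := m) (n := n).
have binj := @block_pos_inj p q m.
have R0 j : block_pos j =
    @section_pos p q m n (@tagnat.Rank _ (fun i : 'I_n.+1 => bsize p q (i + m)) ord0 j).
  by rewrite section_pos_Rank.
pose M := 1%:M - tau *: Hsection p q ell u m n.
(* the source v on block m, as a column of the section *)
pose c : 'cV[R[i]]_(\sum_(i < n.+1) bsize p q (i + m)) :=
  \col_t extend0 (@block_pos p q m) v (@section_pos p q m n t).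
pose V := invmx M *m c.
have NE : N = (n + m)%N by rewrite /n subnK.
exists (extend0 (@section_pos p q m n) (fun t => V t ord0)); split.
- rewrite NE; apply: section_solves => t.
  by rewrite mulmxA mulmxV ?section_unit// mul1mx mxE.
- exact: normle_ext_fin.
- move=> i; rewrite R0 ext_in// mxE.
  under eq_bigr do rewrite [c _ _]mxE ext_sum// mulr_sumr.
  rewrite exchange_big/=; apply: eq_bigr => j _.
  rewrite (bigD1 (@tagnat.Rank _ (fun i : 'I_n.+1 => bsize p q (i + m)) ord0 j))//= [X in _ + X = _]big1 => [|t tj].
    by rewrite -R0 eqxx mul1r addr0 mxE.
  by rewrite R0 inj_eq// (negbTE tj) mul0r mulr0.
Qed.

Lemma Phi_error m N tau : (m <= N)%N -> normc tau * lam < 1 ->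
  (mxnorm s (Phi p q ell u s m tau - Phi_fin p q ell u m N tau)
    <= (K * ((normc tau * lam) ^+ (2 * (N - m + 1)) / (1 - normc tau * lam)))%:E)%E.
Proof.
move=> mN q1; apply: opnorm_le => v v1.
have [x [xs [cx xc] xE]] := Phi_fin_solves v mN q1.
have [y [ys [cy yc] yE]] := Phi_solves v q1.
have binj := @block_pos_inj p q m.
have ec : normle s (fun t => normc (extend0 (@block_pos p q m) v t)) 1.
  by rewrite normc_ext//; apply: normle_ext.
have e0 t : blk t != m -> extend0 (@block_pos p q m) v t = 0.
  by move=> tm; rewrite ext_out// => i e; move: tm; rewrite -e blk_block_pos// eqxx.
have := truncation_error hs A_ge0 A_row pb A_tri mN q1 e0 ec xs xc ys yc.
rewrite mulr1 => /(normle_restrict binj hs); apply: (normle_mono hs) => i.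
rewrite blk_block_pos// leqnn xE yE -sumrB.
rewrite (_ : \sum_(_ < _) _ =
  ((Phi p q ell u s m tau - Phi_fin p q ell u m N tau) *m \col_j v j) i ord0)//.
by rewrite mxE; apply: eq_bigr => j _; rewrite !mxE mulrBl.
Qed.

End Main.

(** * Monotonicity and the backward recursion *)

Section RealRange.
Context {R : realType} {p q : nat} (hp : (1 <= p)%N).
Context {ell u : nat -> nat -> R[i]} {s : \bar R} (hs : (1 <= s)%E).
Local Notation A := (@Htail R p q ell u 0).
Hypothesis A_ge0 : forall x y : hindex p q 0, 0 <= A x y.
Variables (K lam : R).
Hypothesis pb : power_bounded s A K lam.
Variable t : R.
Hypotheses (t0 : 0 <= t) (tlam : t * lam < 1).

Let A_row := @Htail_row p q R ell u 0.
Let A_tri := Htail_tridiag hp (q := q) (ell := ell) (u := u).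

Let normc_t : normc (t%:C : R[i]) * lam < 1.
Proof. by rewrite normc_real ger0_norm. Qed.

Lemma ext_delta m (j : 'I_(bsize p q m)) :
  extend0 (@block_pos p q m) (fun i => (i == j)%:R : R[i]) = (fun x => ((x == block_pos j)%:R : R)%:C).
Proof.
have binj := @block_pos_inj p q m; apply/funext => x.
rewrite ext_sum// (bigD1 j)//= eqxx mulr1 big1 ?addr0 => [|i ij]; last first.
  by rewrite (negbTE ij) mulr0.
by case: eqP.
Qed.

Lemma Phi_fin_monotone m N (i j : 'I_(bsize p q m)) : (m <= N)%N ->
  [/\ 0 <= Phi_fin p q ell u m N t%:C i j,
      Phi_fin p q ell u m N t%:C i j <= Phi_fin p q ell u m N.+1 t%:C i j
    & Phi_fin p q ell u m N.+1 t%:C i j <= Phi p q ell u s m t%:C i j].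
Proof.
move=> mN; pose d (k : 'I_(bsize p q m)) : R[i] := (k == j)%:R.
have pick (M : 'M[R[i]]_(bsize p q m)) : \sum_k M i k * d k = M i j.
  rewrite (bigD1 j)//= /d eqxx mulr1 big1 ?addr0// => k kj.
  by rewrite (negbTE kj) mulr0.
have [x [xs [cx xc] xE]] := Phi_fin_solves hp hs A_ge0 pb d mN normc_t.
have [x' [xs' [cx' xc'] xE']] := Phi_fin_solves hp hs A_ge0 pb d (leqW mN) normc_t.
have [y [ys [cy yc] yE]] := Phi_solves hp hs A_ge0 pb d normc_t.
rewrite /d ext_delta in xs xs' ys.
have f0 (z : hindex p q 0) : 0 <= ((z == block_pos j)%:R : R) by case: eqP.
rewrite -!pick -xE -xE' -yE.
have [? ?] : 0 <= x (block_pos i) /\ x (block_pos i) <= x' (block_pos i).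
  by apply: (solves_le hs A_ge0 A_row pb t0 tlam _ f0 xs xs' xc xc') => z; lia.
have [? ?] : 0 <= x' (block_pos i) /\ x' (block_pos i) <= y (block_pos i).
  by apply: (solves_le hs A_ge0 A_row pb t0 tlam _ f0 xs' ys xc' yc) => z /andP[].
by [].
Qed.

Local Notation D n k := (Drec p q ell u t%:C n k).

(** [D n k] is the Schur complement of block [k] in the matrix of the blocks
    [k, .., k + n]: [D n k *m v] is the source in block [k] whose solution
    has trace [v] there. This property is what the induction on [n] carries;
    invertibility and the sign of the inverse follow from it by the maximum
    principle. *)
Definition lifts n k := forall v : 'cV[R[i]]_(bsize p q k),
  exists x, [/\ solves A (fun z => k <= blk z <= n + k)%N t%:C
      (extend0 (@block_pos p q k) (fun i => (D n k *m v) i ord0)) x,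
    exists c, normle s (fun z => normc (x z)) c &
    forall i, x (block_pos i) = v i ord0].

Lemma lifts_unit n k : lifts n k -> D n k \in unitmx.
Proof.
move=> lf; apply: unitmx_inj => v Dv0.
have [x [xs [c xc] xE]] := lf v.
have e0 : extend0 (@block_pos p q k) (fun i => (D n k *m v) i ord0) = fun=> 0.
  apply/funext => z; rewrite Dv0; case: (extP (@block_pos_inj p q k) _ z) => // i _.
  by rewrite mxE.
rewrite e0 in xs; have x0 := solves0_unique hs A_ge0 A_row pb normc_t xs xc.
by apply/matrixP => i j; rewrite ord1 -xE x0 mxE.
Qed.

(** A column of the inverse is the trace of the solution whose source is a
    unit vector, and nonnegative sources have nonnegative solutions. *)
Lemma lifts_inv_ge0 n k : lifts n k -> forall i j, 0 <= invmx (D n k) i j.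
Proof.
move=> lf i j; have un := lifts_unit lf.
have [x [xs [c xc] xE]] := lf (col j (invmx (D n k))).
have eE : extend0 (@block_pos p q k) (fun i => (D n k *m col j (invmx (D n k))) i ord0)
   = (fun z => ((z == block_pos j)%:R : R)%:C).
  rewrite -ext_delta; congr (extend0 _ _); apply/funext => l.
  by rewrite colE mulmxA mulmxV// mul1mx !mxE andbT.
rewrite eE in xs.
have f0 (z : hindex p q 0) : 0 <= ((z == block_pos j)%:R : R) by case: eqP.
have [+ _] := solves_le hs A_ge0 A_row pb t0 tlam (fun _ h => h) f0 xs xs xc xc (block_pos i).
by rewrite xE mxE.
Qed.

Let Hb_ge0 k l i j : 0 <= Hblock p q ell u k l i j.
Proof. by rewrite HblockE. Qed.

Lemma mulmx_ge0 (a b c : nat) (M1 : 'M[R[i]]_(a, b)) (M2 : 'M[R[i]]_(b, c)) :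
  (forall i j, 0 <= M1 i j) -> (forall i j, 0 <= M2 i j) ->
  forall i j, 0 <= (M1 *m M2) i j.
Proof. by move=> h1 h2 i j; rewrite mxE sumr_ge0// => k _; rewrite mulr_ge0. Qed.

Lemma Drec_one_sub n k : (forall n', n = n'.+1 -> forall i j, 0 <= invmx (D n' k.+1) i j) ->
  exists2 M : 'M[R[i]]_(bsize p q k), (forall i j, 0 <= M i j) & D n k = 1%:M - M.
Proof.
have tC : 0 <= (t%:C : R[i]) by rewrite lecR.
case: n => [|n] h /=.
  exists (t%:C *: Hblock p q ell u k k) => // i j.
  by rewrite mxE mulr_ge0.
exists (t%:C *: Hblock p q ell u k k + t%:C ^+ 2 *:
  (Hblock p q ell u k k.+1 *m invmx (D n k.+1) *m Hblock p q ell u k.+1 k)); last first.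
  by rewrite opprD addrA.
move=> i j; rewrite mxE [X in X + _]mxE [X in _ + X]mxE addr_ge0 ?mulr_ge0 ?exprn_ge0//.
by apply: mulmx_ge0 => //; apply: mulmx_ge0 => //; exact: h.
Qed.

Lemma mxop_block_pos k l (v : 'cV[R[i]]_(bsize p q l)) (i : 'I_(bsize p q k)) :
  mxop A (extend0 (@block_pos p q l) (fun j => v j ord0)) (block_pos i) = (Hblock p q ell u k l *m v) i ord0.
Proof.
rewrite mxop_ext_fin; last exact: block_pos_inj.
by rewrite mxE; apply: eq_bigr => j _; rewrite HblockE.
Qed.

Lemma lifts0 k : lifts 0 k.
Proof.
move=> v; have binj := @block_pos_inj p q k.
exists (extend0 (@block_pos p q k) (fun i => v i ord0)); split.
- split=> z hz.
    by rewrite ext_out// => i e; move: hz; rewrite -e blk_block_pos//; lia.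
  have [i <-] : exists i, @block_pos p q k i = z by apply: block_pos_surj => //; lia.
  rewrite !ext_in// mxop_block_pos /= mulmxBl mul1mx -scalemxAl [X in _ = X + _]mxE.
  by rewrite [X in _ = _ + X + _]mxE [X in _ - X + _]mxE subrK.
- exact: normle_ext_fin.
- by move=> i; rewrite ext_in.
Qed.

(** Given [v] on block [k], its value [v'] on block [k + 1] is forced by
    elimination, and the solution lifting [v'] provides the blocks above. By
    tridiagonality the two parts are coupled only through the blocks between
    [k] and [k + 1]. *)
Lemma liftsS n k : lifts n k.+1 -> lifts n.+1 k.
Proof.
move=> lf v; have un := lifts_unit lf.
have binj := @block_pos_inj p q k; have binj1 := @block_pos_inj p q k.+1.
pose Cv : 'cV[R[i]]_(bsize p q k.+1) := Hblock p q ell u k.+1 k *m v.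
pose v' := invmx (D n k.+1) *m (t%:C *: Cv).
have [x' [[x'0 x'E] [c' xc'] x'v]] := lf v'.
pose x0 := extend0 (@block_pos p q k) (fun i => v i ord0).
have [c0 xc0] := normle_ext_fin hs (fun i => v i ord0) binj.
exists (fun z => x0 z + x' z); split; last first.
- by move=> i; rewrite /x0 ext_in// x'0 ?addr0// blk_block_pos// ltnn.
- exists (c0 + c'); apply: (normle_mono hs) (normleD hs xc0 xc') => z.
  by rewrite !ger0_norm ?addr_ge0 ?normc_ge0 ?le_normcD.
have DE : D n k.+1 *m v' = t%:C *: Cv by rewrite mulmxA mulmxV// mul1mx.
rewrite DE in x'E.
split=> z hz.
  rewrite /x0 ext_out ?add0r ?x'0//; first by lia.
  by move=> i e; move: hz; rewrite -e blk_block_pos//; lia.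
rewrite mxopD//; have [zk|zk] := eqVneq (blk z) k.
  have [i <-] := block_pos_surj hp zk.
  have Ax' : mxop A x' (block_pos i) = (Hblock p q ell u k k.+1 *m v') i ord0.
    rewrite -mxop_block_pos; apply: eq_mxop => // y Ay.
    case: (extP binj1 _ y) => [j ->|out]; first by rewrite x'v.
    apply: x'0; have [yk _] := A_tri Ay; rewrite blk_block_pos// in yk.
    apply/negP => yk1; have [j jy] : exists j, @block_pos p q k.+1 j = y by apply: block_pos_surj; lia.
    exact: out jy.
  rewrite x'0 ?blk_block_pos ?ltnn// addr0 /x0 !ext_in// Ax' mxop_block_pos /=.
  rewrite !mulmxBl mul1mx -!scalemxAl.
  have -> : t%:C ^+ 2 *: (Hblock p q ell u k k.+1 *m invmx (D n k.+1) *m Hblock p q ell u k.+1 k *m v)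
     = t%:C *: (Hblock p q ell u k k.+1 *m v').
    by rewrite /v' -scalemxAr -scalemxAr scalerA -expr2 /Cv !mulmxA.
  rewrite mxE [X in _ = X + _ + _]mxE.
  rewrite [X in _ = _ + X + _ + _]mxE [X in _ = _ - X + _ + _]mxE.
  rewrite [X in _ = _ + X + _]mxE [X in _ = _ - X + _]mxE; ring.
have zk1 : (k.+1 <= blk z <= n + k.+1)%N by lia.
have -> : x0 z = 0.
  by rewrite /x0 ext_out// => i e; move: zk; rewrite -e blk_block_pos// eqxx.
have -> : extend0 (@block_pos p q k) (fun i => (D n.+1 k *m v) i ord0) z = 0.
  by rewrite ext_out// => i e; move: zk; rewrite -e blk_block_pos// eqxx.
rewrite !add0r {1}x'E// mulrDr; congr (_ + _).
case: (extP binj1 _ z) => [j ->|out]; first by rewrite mxop_block_pos mxE.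
rewrite /x0 mxop_ext_fin// big1 ?mulr0// => j _.
have [->|Azj] := eqVneq (A z (block_pos j)) 0; first by rewrite mul0r.
have [_] := A_tri Azj; rewrite blk_block_pos// => zk2.
have [i iz] : exists i, @block_pos p q k.+1 i = z by apply: block_pos_surj => //; lia.
by case: (out i).
Qed.

Lemma lifts_all n k : lifts n k.
Proof. by elim: n k => [|n IH] k; [exact: lifts0|exact: liftsS]. Qed.

Lemma Drec_Mmatrix n k : nonsingular_Mmatrix (D n k).
Proof.
have [|M M0 DE] := @Drec_one_sub n k.
  by move=> n' _; apply: lifts_inv_ge0; exact: lifts_all.
split; last by apply: lifts_inv_ge0; exact: lifts_all.
- by move=> i j; rewrite DE !mxE realB ?ger0_real ?ler0n.
- by move=> i j ij; rewrite DE !mxE (negbTE ij) mulr0n add0r oppr_le0.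
- by apply: lifts_unit; exact: lifts_all.
Qed.

End RealRange.

(** * The growth constant, and the theorem *)

(** An arbitrary constant [K] for the growth rate [gamma] shows that the
    supremum is finite, and then the supremum is itself such a constant. *)
Lemma Cgamma_power_bounded (R : realType) (p q : nat) (ell u : nat -> nat -> R[i])
    (s : \bar R) (K gamma : R) : (1 <= s)%E ->
  (forall x y : hindex p q 0, 0 <= Htail ell u x y) -> 0 < gamma ->
  power_bounded s (@Htail R p q ell u 0) K gamma ->
  exists2 C, Cgamma p q ell u s gamma = C%:E &
    power_bounded s (@Htail R p q ell u 0) C gamma.
Proof.
set A := @Htail R p q ell u 0 => hs A_ge0 g0 [K0 _ pb].
have A_row := @Htail_row p q R ell u 0.
have gk k : 0 < gamma ^+ k by rewrite exprn_gt0.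
have op_le k : (opnorm s (iter k (mxop A)) <= (K * gamma ^+ k)%:E)%E.
  apply: opnorm_le => x x1; have := pb k _ _ x1; rewrite mulr1.
  apply: (normle_mono hs) => i; rewrite !ger0_norm ?normc_ge0 ?normc_iter_mxop//.
  by apply: iter_rop_ge0 => // j; exact: normc_ge0.
have op_ge0 k : (0 <= opnorm s (iter k (mxop A)))%E.
  apply: le_trans (lsnorm_ge0 (iter k (mxop A) 0)) (ereal_sup_ubound _); exists 0 => //=.
  apply: (lsnorm_normle _ _).2; under [X in normle s X]funext do rewrite normc0.
  exact: normle_weak ler01 (normle0 hs _).
have C_le : (Cgamma p q ell u s gamma <= K%:E)%E.
  apply: ge_ereal_sup => _ [k _ <-]; rewrite lee_pdivrMr//.
have C_ge k : (opnorm s (iter k (mxop A)) * (gamma ^- k)%:E <= Cgamma p q ell u s gamma)%E.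
  by apply: ereal_sup_ubound; exists k.
have C0 : (0 <= Cgamma p q ell u s gamma)%E.
  by apply: le_trans (C_ge 0%N); rewrite mule_ge0// lee_fin invr_ge0 ltW.
have Cfin : Cgamma p q ell u s gamma \is a fin_num.
  by rewrite ge0_fin_numE//; apply: le_lt_trans C_le (ltry _).
exists (fine (Cgamma p q ell u s gamma)); first by rewrite fineK.
split; [exact: fine_ge0|exact: ltW|] => k f c fc.
have homog a (x : hindex p q 0 -> R[i]) i : lspace s x ->
    iter k (mxop A) (fun j => a * x j) i = a * iter k (mxop A) x i.
  move=> _; elim: k {op_le op_ge0 C_ge} i => //= k IH i.
  by rewrite -mxopZ//; congr (mxop _ _ i); apply/funext.
have fc' : normle s (fun i => normc ((f i)%:C : R[i])) c.
  by apply: (normle_mono hs) fc => i; rewrite normc_real normr_id.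
have := opnorm_bound hs homog _ _ fc'.
move=> /(_ (fine (Cgamma p q ell u s gamma) * gamma ^+ k)) h.
apply: (normle_mono hs) (h _ _) => [i||].
- by rewrite iter_mxop_real// normc_real normr_id.
- by rewrite mulr_ge0 ?fine_ge0// ltW.
- by rewrite EFinM fineK// -lee_pdivrMr// C_ge.
Qed.

Lemma ex_growth_rate (R : realType) (a rho : R) : 0 <= a -> 0 <= rho -> a * rho < 1 ->
  exists2 gamma, rho < gamma & a * gamma < 1.
Proof.
move=> a0 r0 h; have a1 : 0 < a + 1 by lra.
have e0 : 0 < (1 - a * rho) / (2 * (a + 1)) by rewrite divr_gt0; lra.
exists (rho + (1 - a * rho) / (2 * (a + 1))); first by lra.
have : a * ((1 - a * rho) / (2 * (a + 1))) <= (1 - a * rho) / 2.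
  rewrite (_ : a * _ = a / (a + 1) * ((1 - a * rho) / 2)); last by field; lra.
  by rewrite ler_piMl ?ler_pdivrMr//; lra.
lra.
Qed.

Theorem theorem3p35 (R : realType) (p q : nat) (hp : (1 <= p)%N) (hq : (1 <= q)%N)
    (ell u : nat -> nat -> R[i]) (s : \bar R) (hs : (1 <= s)%E)
    (Hbounded : bounded_op s (mxop (@Htail R p q ell u 0)))
    (Hnonneg : forall x y : hindex p q 0, 0 <= Htail ell u x y) :
  let rho := spectral_radius s (mxop (@Htail R p q ell u 0)) in
  (* the inverses defining Phi and Phi_fin exist *)
  (forall (m : nat) (tau : R[i]), normc tau * rho < 1 ->
     (exists G, inverse_op s
        (fun x => x - tau *: mxop (@Htail R p q ell u m) x) G) /\
     (forall N, (m <= N)%N ->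
        1%:M - tau *: Hsection p q ell u m (N - m) \in unitmx)) /\
  (* locally uniform convergence on the disc |tau| rho < 1 *)
  (forall (m : nat) (tau0 : R[i]), normc tau0 * rho < 1 ->
     exists2 delta : R, 0 < delta &
     forall eps : R, 0 < eps -> exists N0 : nat, forall N : nat, (N0 <= N)%N ->
     forall tau : R[i], normc (tau - tau0) < delta -> normc tau * rho < 1 ->
       (mxnorm s (Phi p q ell u s m tau - Phi_fin p q ell u m N tau)
          < eps%:E)%E) /\
  (* quantitative bound *)
  (forall (tau : R[i]) (gamma : R),
     normc tau * rho < 1 -> rho < gamma -> normc tau * gamma < 1 ->
     (Cgamma p q ell u s gamma < +oo)%E /\
     (forall m N : nat, (m <= N)%N ->
       (mxnorm s (Phi p q ell u s m tau - Phi_fin p q ell u m N tau)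
          <= Cgamma p q ell u s gamma
             * ((normc tau * gamma) ^+ (2 * (N - m + 1))
                / (1 - normc tau * gamma))%:E)%E)) /\
  (* real range 0 <= tau < rho^-1, with rho^-1 = +oo if rho = 0 *)
  (forall tau : R, 0 <= tau -> tau * rho < 1 ->
     (forall m N : nat, (m <= N)%N ->
        forall i j : 'I_(bsize p q m),
          [/\ 0 <= Phi_fin p q ell u m N tau%:C i j,
              Phi_fin p q ell u m N tau%:C i j
                <= Phi_fin p q ell u m N.+1 tau%:C i j
            & Phi_fin p q ell u m N.+1 tau%:C i j
                <= Phi p q ell u s m tau%:C i j]) /\
     (forall m N k : nat, (m <= k <= N)%N ->
        nonsingular_Mmatrix (Dmx p q ell u N k tau%:C))).
Proof.
move=> rho.
have A_row := @Htail_row p q R ell u 0.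
have rho0 : 0 <= rho := spectral_radius_ge0 hs Hnonneg A_row Hbounded.
have growth (a : R) : 0 <= a -> a * rho < 1 ->
    exists gamma K : R, a * gamma < 1 /\ power_bounded s (@Htail R p q ell u 0) K gamma.
  move=> a0 /(ex_growth_rate a0 rho0)[gamma rg ag].
  have [K pb] := spectral_radius_power_bounded hs Hnonneg A_row Hbounded rg.
  by exists gamma, K.
split; last split; last split.
- move=> m tau /(growth _ (normc_ge0 _))[gamma [K [tg pb]]].
  by split=> [|N mN]; [exact: (tail_inverse hs Hnonneg pb)|exact: (section_unit hp hs Hnonneg pb)].
- move=> m tau0 /(growth _ (normc_ge0 _))[gamma [K [tg pb]]].
  have [K0 g0 _] := pb.
  rewrite mulrC in tg; have [r0 tr0 gr0] := ex_growth_rate g0 (normc_ge0 tau0) tg.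
  have r00 : 0 <= r0 := le_trans (normc_ge0 tau0) (ltW tr0).
  have q01 : 0 <= gamma * r0 < 1 by rewrite mulr_ge0.
  exists (r0 - normc tau0); first by rewrite subr_gt0.
  move=> eps eps0; have [n0 hn0] := geometric_lt (K / (1 - gamma * r0)) q01 eps0.
  exists (m + n0)%N => N hN tau td _.
  have mN : (m <= N)%N by exact: leq_trans (leq_addr _ _) hN.
  have tau_le : normc tau <= r0.
    rewrite -(subrK tau0 tau); apply: le_trans (le_normcD _ _) _.
    by rewrite -lerBrDr ltW.
  have qq : normc tau * gamma <= gamma * r0 by rewrite mulrC ler_wpM2l.
  have qt0 : 0 <= normc tau * gamma by rewrite mulr_ge0 ?normc_ge0.
  have q1 : normc tau * gamma < 1 by exact: le_lt_trans qq gr0.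
  apply: le_lt_trans (Phi_error hp hs Hnonneg pb mN q1) _; rewrite lte_fin.
  apply: le_lt_trans (hn0 (2 * (N - m + 1))%N _); last first.
    by rewrite mul2n -addnn !addn1; apply: leq_trans (leq_addr _ _); rewrite leqW// leq_subRL.
  rewrite -mulrA ler_wpM2l// mulrC; apply: ler_pM.
  + by rewrite invr_ge0 subr_ge0 ltW.
  + exact: exprn_ge0.
  + by rewrite lef_pV2 ?posrE ?subr_gt0// lerB.
  + by apply: lerXn2r; rewrite ?nnegrE// mulr_ge0.
- move=> tau gamma _ rg tg.
  have [K pb] := spectral_radius_power_bounded hs Hnonneg A_row Hbounded rg.
  have [C -> pbC] := Cgamma_power_bounded hs Hnonneg (le_lt_trans rho0 rg) pb.
  split=> [|m N mN]; first exact: ltry.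
  by rewrite -EFinM; exact: (Phi_error hp hs Hnonneg pbC).
- move=> tau tau0 /(growth _ tau0)[gamma [K [tg pb]]].
  split=> [m N mN i j|m N k _]; first exact: (Phi_fin_monotone hp hs Hnonneg pb).
  exact: (Drec_Mmatrix hp hs Hnonneg pb).
Qed.
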